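(* Let $V:\mathcal X\to\mathbb R_+$ be continuous and let $\mathfrak F=\{f\in B(\mathcal X):|f(x)|\le1+V(x)\ \forall x\}$ satisfy Hypothesis $(\mathbf{H_2})$. Then the following are equivalent: (i) $\Phi$ admits a unique invariant probability measure $\mu$ with $\mathfrak F\subset L^1(\mu)$ and $\lim_{t\to\infty}d_V(Q_t(x,\cdot),\mu)=0$ for all $x\in\mathcal X$; (ii) $\Phi$ is uniformly Cesàro eventually continuous with respect to $\mathfrak F$ on $\mathcal X$, and there exists $z\in\mathcal X$ such that $\Phi$ satisfies $(\mathcal C_2)$ at $z$; (iii) there exists $z\in\mathcal X$ such that $\Phi$ is uniformly Cesàro eventually continuous with respect to $\mathfrak F$ at $z$ and satisfies $(\mathcal C_2)$ at $z$.
   Context: Standing setting: $(\mathcal{X},\rho)$ is a Polish space; $\Phi=\{\Phi_t\}_{t\ge0}$ is a càdlàg Feller Markov process on $\mathcal{X}$ (hence strong Markov) with laws $\mathbb{P}^x$ and transition kernels $P_t(x,\cdot)$. $B(\mathcal X)$: Borel real functions; $B(z,r)$: open ball. $\mathcal{A}=\{f\in B(\mathcal{X}):\int|f|\,dP_t(x,\cdot)<\infty\ \forall x,t\}$; for $f\in\mathcal A$, $P_tf(x)=\int f\,dP_t(x,\cdot)$, $Q_tf(x)=\frac1t\int_0^tP_sf(x)ds$; $Q_t(x,\cdot)=\frac1t\int_0^tP_s(x,\cdot)ds$. For probability measures $\mu,\nu$ with $\int V d\mu,\int Vd\nu<\infty$, $d_V(\mu,\nu)=\inf_\pi\int_{\{x\neq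 y\}}(2+V(x)+V(y))\pi(dx,dy)$, the infimum over couplings $\pi$ of $\mu$ and $\nu$. $(\mathcal C_2)$ at $z$: for every $r>0$, $\inf_{x\in\mathcal X}\limsup_{t\to\infty}Q_t(x,B(z,r))>0$. $\Phi$ is uniformly Cesàro eventually continuous with respect to $\mathfrak F$ at $x$ if $\limsup_{x'\to x}\limsup_{t\to\infty}\sup_{f\in\mathfrak F}|Q_tf(x')-Q_tf(x)|=0$; ''on $\mathcal X$'' means at every point. Uniform integrability of $\{\xi_t\}$: $\lim_{K\to\infty}\sup_t\mathbb E(|\xi_t|\chi_{\{|\xi_t|\ge K\}})=0$. Hypothesis $(\mathbf{H_2})$: there is $\tilde V\in\mathcal A$ with $|f|\le\tilde V$ for all $f\in\mathfrak F$, such that $\{\tilde V(\Phi_t)\}_{t\ge0}$ is uniformly integrable under every $\mathbb P^x$. *)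

(* Defs.v *)
From HB Require Import structures.
From mathcomp Require Import all_boot all_order all_algebra.
From mathcomp Require Import all_classical all_reals all_analysis measurable_realfun.
Set Implicit Arguments. Unset Strict Implicit. Unset Printing Implicit Defensive.
Import Order.TTheory GRing.Theory Num.Theory.
Local Open Scope classical_set_scope.
Local Open Scope ring_scope.

Section Defs.
Context {R : realType}.

Section Metric.
Context {X : Type} (rho : X -> X -> R).

Definition is_metric : Prop :=
  [/\ forall x y, 0 <= rho x y,
      forall x y, rho x y = 0 <-> x = y,
      forall x y, rho x y = rho y x &
      forall x y z, rho x z <= rho x y + rho y z].

Definition rball (z : X) (r : R) : set X := [set y | rho z y < r].

Definition ropen (A : set X) : Prop :=
  forall x, A x -> exists r, 0 < r /\ rball x r `<=` A.

Definition rcauchy (u : nat -> X) : Prop :=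
  forall e, 0 < e -> exists N, forall m n, (N <= m)%N -> (N <= n)%N -> rho (u m) (u n) < e.

Definition polish : Prop :=
  [/\ is_metric,
      (forall u, rcauchy u -> exists l, forall e, 0 < e ->
          exists N, forall n, (N <= n)%N -> rho (u n) l < e) &
      (exists D : nat -> X, forall x e, 0 < e -> exists n, rho x (D n) < e)].

Definition rcontinuous (f : X -> R) : Prop :=
  forall x e, 0 < e -> exists d, 0 < d /\ forall y, rho x y < d -> `|f y - f x| < e.

Definition rlimsup_at (x : X) (g : X -> \bar R) : \bar R :=
  ereal_inf [set ereal_sup (g @` rball x d) | d in [set d : R | 0 < d]].

Definition cadlag (w : R -> X) : Prop :=
  (forall t, 0 <= t -> forall e, 0 < e -> exists d, 0 < d /\
      forall s, t <= s -> s < t + d -> rho (w t) (w s) < e) /\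
  (forall t, 0 < t -> exists l, forall e, 0 < e -> exists d, 0 < d /\
      forall s, t - d < s -> s < t -> rho l (w s) < e).
End Metric.

Definition limsup_infty (g : R -> \bar R) : \bar R :=
  ereal_inf [set ereal_sup (g @` [set t | T <= t]) | T in [set: R]].

Section Process.
Context {d : measure_display} {X : measurableType d}
        {dO : measure_display} {Omega : measurableType dO}
        (Px : X -> probability Omega R) (Phi : R -> Omega -> X).

Definition Pt (t : R) (x : X) (A : set X) : \bar R := Px x (Phi t @^-1` A).

(* P_t f (x) = \int f dP_t(x, .) = E^x f(Phi_t) *)
Definition Pf (t : R) (f : X -> R) (x : X) : R :=
  fine (\int[Px x]_w (f (Phi t w))%:E)%E.

Definition Qf (t : R) (f : X -> R) (x : X) : R :=
  t^-1 * fine (\int[lebesgue_measure]_(s in [set s : R | (0 <= s <= t)%R]) (Pf s f x)%:E)%E.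

Definition Qt (t : R) (x : X) (A : set X) : R := Qf t (\1_A) x.

Definition nat_filtration (s : R) : set (set Omega) :=
  <<s [set E | exists r (B : set X), [/\ 0 <= r <= s, measurable B & E = Phi r @^-1` B]] >>.

Definition in_A (f : X -> R) : Prop :=
  measurable_fun setT f /\
  forall x t, 0 <= t -> (Px x).-integrable setT (fun w => (f (Phi t w))%:E).

Definition cadlag_feller_markov (rho : X -> X -> R) : Prop :=
  [/\ (forall t, 0 <= t -> measurable_fun setT (Phi t)),
      (forall w, cadlag rho (fun t => Phi t w)),
      (forall x, Px x [set w | Phi 0 w = x] = 1%E) /\
      (forall t B, 0 <= t -> measurable B -> measurable_fun [set: X] (fun y => Pt t y B)),
      (forall x s t A B, 0 <= s -> 0 <= t -> nat_filtration s A -> measurable B ->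
          Px x (A `&` Phi (s + t) @^-1` B) = (\int[Px x]_(w in A) Pt t (Phi s w) B)%E) &
      (forall t f, 0 <= t -> (exists M, forall x, `|f x| <= M) -> rcontinuous rho f ->
          rcontinuous rho (Pf t f))].

Definition H2 (FF : set (X -> R)) : Prop :=
  exists Vt : X -> R, [/\ in_A Vt,
    (forall f, FF f -> forall x, `|f x| <= Vt x) &
    forall x, (fun K : R => ereal_sup [set (\int[Px x]_(w in [set w | (K <= `|Vt (Phi t w)|)%R])
                                           (`|Vt (Phi t w)|)%R%:E)%E | t in [set t : R | 0 <= t]])
              @ +oo%R --> 0%E].

Definition ucec_at (rho : X -> X -> R) (FF : set (X -> R)) (x : X) : Prop :=
  rlimsup_at rho x (fun x' => limsup_infty (fun t =>
      ereal_sup [set (`|Qf t f x' - Qf t f x|)%:E | f in FF])) = 0%E.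

Definition C2_at (rho : X -> X -> R) (z : X) : Prop :=
  forall r, 0 < r ->
    (0 < ereal_inf [set limsup_infty (fun t => (Qt t x (rball rho z r))%:E) | x in [set: X]])%E.

Definition is_invariant (mu : probability X R) : Prop :=
  forall t A, 0 <= t -> measurable A -> (\int[mu]_y Pt t y A)%E = mu A.

Definition dV_Q (V : X -> R) (t : R) (x : X) (mu : probability X R) : \bar R :=
  ereal_inf [set (\int[pi]_(p in [set p : X * X | p.1 <> p.2]) (2 + V p.1 + V p.2)%R%:E)%E
            | pi in [set pi : probability (X * X)%type R |
                 forall A, measurable A ->
                   pi (A `*` setT) = (Qt t x A)%:E /\ pi (setT `*` A) = mu A]].
End Process.

Definition FF_V {d} {X : measurableType d} (V : X -> R) : set (X -> R) :=
  [set f : X -> R | measurable_fun setT f /\ forall x, `|f x| <= 1 + V x].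

End Defs.

(* Main.v *)
Require Import Defs.
From HB Require Import structures.
From mathcomp Require Import all_boot all_order all_algebra.
From mathcomp Require Import all_classical all_reals all_analysis measurable_realfun.
From mathcomp Require Import giry lra ring.
Set Implicit Arguments. Unset Strict Implicit. Unset Printing Implicit Defensive.
Import Order.TTheory GRing.Theory Num.Theory.
Import numFieldNormedType.Exports.
Local Open Scope classical_set_scope.
Local Open Scope ring_scope.

(** The implication (iii) => (i) carries the weight. Write [Q_T(x)] for the time averages and
    [q_T = Q_T(z)].
    (1) Merging: if [L] bounds [limsup_T |Q_T f(y) - q_T(f)|] for all [y], then averaging over one
    [Q_t(x)], which charges a ball around [z] with mass at least [a] (C2), gives
    [L <= L - a (L - e)]; hence [L = 0].
    (2) Domination: total variation is tested on continuous functions, so merging and the Feller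
    property make [X] a countable union of closed sets on which merging is uniform in time up to
    [e]. Baire's theorem, relative to the set of points all of whose balls recur (it contains [z]
    and has full [q_T]-measure), yields a recurrent ball with uniform merging; restarting there
    gives [gam (q_T(f) - e) <= q_S(f) + T / S] for arbitrarily large [S].
    (3) As disjoint sets cannot all have large [q_S]-measure, [q_T(A_n)] is eventually small,
    uniformly in [T], whenever [A_n] decreases to the empty set. Applied to the complements of the
    closed sets of (2) this makes [q_T] Cauchy in total variation; its limit is invariant.
    (4) Uniform integrability and a maximal coupling turn total variation into [d_V]. *)

(** * Expectations of functions with values in the unit interval *)

Local Notation expect m f := (Rintegral m setT f).

Section UnitFunctions.
Context {R : realType} {d : measure_display} {X : measurableType d}.
Implicit Types (f g : X -> R) (A : set X).

Definition unit_fun f : Prop := measurable_fun setT f /\ forall x, 0 <= f x <= 1.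

Lemma measurable_unit_fun f : unit_fun f -> measurable_fun setT f.
Proof. by case. Qed.

Lemma unit_fun_ge0 f x : unit_fun f -> 0 <= f x.
Proof. by case=> _ /(_ x)/andP[]. Qed.

Lemma unit_fun_le1 f x : unit_fun f -> f x <= 1.
Proof. by case=> _ /(_ x)/andP[]. Qed.

Lemma unit_fun_norm f x : unit_fun f -> `|f x| <= 1.
Proof. by move=> uf; rewrite ger0_norm ?unit_fun_le1 ?unit_fun_ge0. Qed.

Lemma unit_fun_cst (c : R) : 0 <= c <= 1 -> unit_fun (fun=> c).
Proof. by split => //; exact: measurable_cst. Qed.

Lemma unit_fun0 : unit_fun (fun=> 0).
Proof. by apply: unit_fun_cst; rewrite lexx ler01. Qed.

Lemma unit_fun1 : unit_fun (fun=> 1).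
Proof. by apply: unit_fun_cst; rewrite lexx ler01. Qed.

Lemma unit_fun_indic A : measurable A -> unit_fun \1_A.
Proof.
move=> mA; split; first exact: measurable_indic.
by move=> x; rewrite indicE; case: (x \in A); rewrite ?lexx ?ler01.
Qed.

Lemma unit_fun1B f : unit_fun f -> unit_fun (fun x => 1 - f x).
Proof.
move=> [mf f01]; split; first exact: measurable_funB.
by move=> x; have := f01 x; lra.
Qed.

Lemma unit_fun_dist f g : unit_fun f -> unit_fun g -> unit_fun (fun x => `|f x - g x|).
Proof.
move=> [mf f01] [mg g01]; split.
  by apply: measurableT_comp => //; exact: measurable_funB.
by move=> x; rewrite normr_ge0/= ler_norml; have := f01 x; have := g01 x; lra.
Qed.

Lemma unit_fun_max f g : unit_fun f -> unit_fun g -> unit_fun (fun x => Num.max (f x) (g x)).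
Proof.
move=> [mf f01] [mg g01]; split; first exact: measurable_maxr.
by move=> x; case: (leP (f x) (g x)) => _; [exact: g01 | exact: f01].
Qed.

Lemma unit_funM f g : unit_fun f -> unit_fun g -> unit_fun (fun x => f x * g x).
Proof.
move=> uf ug; split; first by apply: measurable_funM; exact: measurable_unit_fun.
by move=> x; rewrite mulr_ge0 ?mulr_ile1 ?unit_fun_ge0 ?unit_fun_le1.
Qed.

Lemma unit_funZ f (c : R) : 0 <= c <= 1 -> unit_fun f -> unit_fun (fun x => c * f x).
Proof. by move=> c01; exact/unit_funM/unit_fun_cst. Qed.

End UnitFunctions.

Lemma unit_fun_comp (R : realType) d d' (X : measurableType d) (Y : measurableType d')
    (h : Y -> X) (f : X -> R) :
  measurable_fun setT h -> unit_fun f -> unit_fun (f \o h).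
Proof. by move=> mh [mf f01]; split=> [|y]; [exact: measurableT_comp mf mh | exact: f01]. Qed.

Section Expectation.
Context {R : realType} {d : measure_display} {X : measurableType d}.
Variable m : probability X R.
Implicit Types (f g : X -> R) (A B : set X).

Lemma integrable_bounded f (M : R) : measurable_fun setT f ->
  (forall x, `|f x| <= M) -> m.-integrable setT (EFin \o f).
Proof.
move=> mf fM; apply: measurable_bounded_integrable => //.
  by rewrite -ge0_fin_numE ?fin_num_measure.
by exists M; split=> [|K MK x _]; [exact: num_real | exact: le_trans (fM x) (ltW MK)].
Qed.

Lemma unit_fun_integrable f : unit_fun f -> m.-integrable setT (EFin \o f).
Proof.
move=> uf; apply: (@integrable_bounded _ 1); first exact: measurable_unit_fun.
by move=> x; exact: unit_fun_norm.
Qed.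

Lemma EFin_expect f : unit_fun f -> (expect m f)%:E = (\int[m]_x (f x)%:E)%E.
Proof. by move=> uf; rewrite fineK//; exact/integrable_fin_num/unit_fun_integrable. Qed.

Lemma expect_cst (c : R) : expect m (fun=> c) = c.
Proof. by rewrite Rintegral_cst//= probability_setT mulr1. Qed.

Lemma expect_indic A : measurable A -> (expect m \1_A)%:E = m A.
Proof. by move=> mA; rewrite EFin_expect ?integral_indic ?setIT//; exact: unit_fun_indic. Qed.

Lemma expect_indic0 : expect m \1_set0 = 0.
Proof. by apply: EFin_inj; rewrite expect_indic// measure0. Qed.

Lemma expect_indicT : expect m \1_setT = 1.
Proof. by apply: EFin_inj; rewrite expect_indic// probability_setT. Qed.

Lemma le_expect f g : unit_fun f -> unit_fun g -> (forall x, f x <= g x) ->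
  expect m f <= expect m g.
Proof. by move=> uf ug fg; apply: le_Rintegral => //; exact: unit_fun_integrable. Qed.

Lemma expect_ge0 f : unit_fun f -> 0 <= expect m f.
Proof. by move=> uf; apply: Rintegral_ge0 => x _; exact: unit_fun_ge0. Qed.

Lemma expect_le1 f : unit_fun f -> expect m f <= 1.
Proof.
move=> uf; rewrite -(expect_cst 1); apply: le_expect => //; first exact: unit_fun1.
by move=> x; exact: unit_fun_le1.
Qed.

Lemma expectZ f (c : R) : unit_fun f -> expect m (fun x => c * f x) = c * expect m f.
Proof. by move=> uf; apply: RintegralZl => //; exact: unit_fun_integrable. Qed.

Lemma expect1B f : unit_fun f -> expect m (fun x => 1 - f x) = 1 - expect m f.
Proof.
by move=> uf; rewrite RintegralB ?expect_cst//; apply: unit_fun_integrable => //;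
  exact: unit_fun1.
Qed.

Lemma le_expect_lin f g h (a b : R) : unit_fun f -> unit_fun g -> unit_fun h ->
  (forall x, h x <= a * f x + b * g x) -> expect m h <= a * expect m f + b * expect m g.
Proof.
move=> uf ug uh hfg; rewrite -!expectZ//.
have iZ (c : R) u : unit_fun u -> m.-integrable setT (EFin \o (fun x => c * u x)).
  by move=> uu; exact: (integrableZl measurableT c (unit_fun_integrable uu)).
rewrite -RintegralD//; [|exact: iZ..].
apply: le_Rintegral => //; first exact: unit_fun_integrable.
exact: integrableD (iZ _ _ _) (iZ _ _ _).
Qed.

Lemma expect_dist f g : unit_fun f -> unit_fun g ->
  `|expect m f - expect m g| <= expect m (fun x => `|f x - g x|).
Proof.
move=> uf ug; have [if_ ig] := (unit_fun_integrable uf, unit_fun_integrable ug).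
by rewrite -RintegralB//; apply: le_normr_Rintegral => //; exact: (integrableB measurableT if_ ig).
Qed.

Lemma expect_dist_trans f g h : unit_fun f -> unit_fun g -> unit_fun h ->
  expect m (fun x => `|f x - h x|) <=
  expect m (fun x => `|f x - g x|) + expect m (fun x => `|g x - h x|).
Proof.
move=> uf ug uh; rewrite -[leRHS]mul1r mulrDr; apply: le_expect_lin; [exact: unit_fun_dist..|].
by move=> x; rewrite !mul1r; exact: ler_distD.
Qed.

Lemma le_expect_indic A B : measurable A -> measurable B -> A `<=` B ->
  expect m \1_A <= expect m \1_B.
Proof. by move=> mA mB AB; rewrite -lee_fin !expect_indic// le_measure ?inE. Qed.

Lemma expect_indicC A : measurable A -> expect m \1_(~` A) = 1 - expect m \1_A.
Proof.
move=> mA; apply: EFin_inj.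
by rewrite EFinB !expect_indic ?probability_setC//; exact: measurableC.
Qed.

Lemma expect_indicU A B : measurable A -> measurable B -> [disjoint A & B] ->
  expect m \1_(A `|` B) = expect m \1_A + expect m \1_B.
Proof.
move=> mA mB /disj_set2P AB; apply: EFin_inj.
by rewrite EFinD !expect_indic ?measureU//; exact: measurableU.
Qed.

Lemma expect_indicD A B : measurable A -> measurable B -> A `<=` B ->
  expect m \1_(B `\` A) = expect m \1_B - expect m \1_A.
Proof.
move=> mA mB AB; have mBA : measurable (B `\` A) by exact: measurableD.
rewrite -[in RHS](setDUK AB) expect_indicU//; first by rewrite addrC addKr.
by apply/disj_set2P; rewrite setDE setICA setICr setI0.
Qed.

Lemma expect_indicI_full A B : measurable A -> measurable B -> expect m \1_B = 1 ->
  expect m \1_(A `&` B) = expect m \1_A.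
Proof.
move=> mA mB mB1; have mAB : measurable (A `&` B) by exact: measurableI.
have : expect m \1_(A `\` (A `&` B)) <= expect m \1_(~` B).
  apply: le_expect_indic; [exact: measurableD|exact: measurableC|].
  by move=> x [Ax nABx] Bx; apply: nABx.
have AB_A : A `&` B `<=` A by exact: subIsetl.
rewrite expect_indicC// mB1 subrr expect_indicD//.
have : expect m \1_(A `&` B) <= expect m \1_A by exact: le_expect_indic.
by lra.
Qed.

Lemma expect_cvg (f_ : nat -> X -> R) f : (forall n, unit_fun (f_ n)) ->
  unit_fun f -> (forall x, f_ ^~ x @ \oo --> f x) ->
  (fun n => expect m (f_ n)) @ \oo --> expect m f.
Proof.
move=> uf_ uf ff.
have [|||||_ _] := @dominated_convergence _ _ _ m setT measurableT
  (fun n x => (f_ n x)%:E) (EFin \o f) (EFin \o cst 1).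
- by move=> n; apply/measurable_EFinP; exact: measurable_unit_fun.
- exact/measurable_EFinP/measurable_unit_fun.
- by apply: aeW => x _; apply: cvg_EFin; [exact: nearW | exact: ff].
- exact: finite_measure_integrable_cst.
- by apply: aeW => x n _ /=; rewrite lee_fin; exact: unit_fun_norm.
- by rewrite -EFin_expect// => /fine_cvg.
Qed.

(* Reverse Fatou: [max (f_ n) b] converges pointwise to [b]. *)
Lemma expect_limsup_le (f_ : nat -> X -> R) b (e : R) : (forall n, unit_fun (f_ n)) ->
  unit_fun b -> (forall x, \forall n \near \oo, f_ n x <= b x) -> 0 < e ->
  \forall n \near \oo, expect m (f_ n) <= expect m b + e.
Proof.
move=> uf_ ub fb e0.
have umax n := unit_fun_max (uf_ n) ub.
have cvg_max x : Num.max (f_ n x) (b x) @[n --> \oo] --> b x.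
  by apply: cvg_near_cst; apply: filterS (fb x) => n /max_idPr.
have /cvgrPdist_lt/(_ _ e0) := expect_cvg umax ub cvg_max.
apply: filterS => n; rewrite distrC ltr_distl => /andP[_ maxb].
apply: le_trans (ltW maxb); apply: le_expect => // x.
by rewrite le_max lexx.
Qed.

Lemma indic_bigcup_cvg (F : nat -> set X) x :
  (\1_(\big[setU/set0]_(i < n) F i) x : R) @[n --> \oo] --> (\1_(\bigcup_n F n) x : R).
Proof.
apply: cvg_near_cst; have [[k _ Fkx]|Fx] := pselect ((\bigcup_k F k) x).
  exists k.+1 => // n /= kn; rewrite !indicE !mem_set//; first by exists k.
  by rewrite -bigcup_mkord; exists k.
apply: nearW => n; rewrite !indicE !memNset//.
by rewrite -bigcup_mkord => -[k _ Fkx]; apply: Fx; exists k.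
Qed.

Lemma expect_indic_bigcup (F : nat -> set X) : (forall n, measurable (F n)) ->
  (fun n => expect m \1_(\big[setU/set0]_(i < n) F i)) @ \oo -->
  expect m \1_(\bigcup_n F n).
Proof.
move=> mF; apply: expect_cvg => [n||x].
- by apply: unit_fun_indic; exact: bigsetU_measurable.
- by apply: unit_fun_indic; exact: bigcupT_measurable.
- exact: indic_bigcup_cvg.
Qed.

Lemma expect_indic_cvg0 (A : nat -> set X) : (forall n, measurable (A n)) ->
  (forall x, \forall n \near \oo, ~ A n x) -> expect m \1_(A n) @[n --> \oo] --> 0.
Proof.
move=> mA Aout; rewrite -(expect_cst 0); apply: expect_cvg => [n||x].
- exact: unit_fun_indic.
- exact: unit_fun0.
- by apply: cvg_near_cst; apply: filterS (Aout x) => n nAx; rewrite indicE memNset.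
Qed.

End Expectation.

Lemma unit_fun_expect (R : realType) d d' (X : measurableType d) (Y : measurableType d')
    (K : Y -> probability X R) (f : X -> R) :
  (forall A, measurable A -> measurable_fun setT (fun y => K y A)) ->
  unit_fun f -> unit_fun (fun y => expect (K y) f).
Proof.
move=> mK uf; split=> [|y]; last by rewrite expect_le1// expect_ge0.
apply: (measurableT_comp (fine_measurable measurableT)).
apply: (@measurable_fun_integral_kernel _ _ _ _ _ (fun y => K y)) => //.
- by move=> x; rewrite lee_fin unit_fun_ge0.
- exact/measurable_EFinP/measurable_unit_fun.
Qed.

(** * Hahn decomposition and total variation *)

Section Hahn.
Context {R : realType} {d : measure_display} {X : measurableType d}.
Implicit Types (f : X -> R) (A : set X).

(* [m] is the minimum of [m1] and [m2]; [n1] and [n2] are their excesses over it. *)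
Lemma common_part (m1 m2 : probability X R) : exists (P : set X) (m : {measure set X -> \bar R})
    (n1 n2 : {finite_measure set X -> \bar R}),
  [/\ measurable P,
      forall A, measurable A -> m1 A = (m A + n1 A)%E,
      forall A, measurable A -> m2 A = (m A + n2 A)%E &
      n1 setT = (m1 P - m2 P)%E /\ n2 setT = n1 setT].
Proof.
pose nu : {charge set X -> \bar R} :=
  cadd (charge_of_finite_measure m1) (cscale (-1) (charge_of_finite_measure m2)).
have nuE A : nu A = (m1 A - m2 A)%E by rewrite /nu/= /cadd/= cscaleN1.
have [P [N nuPN]] := Hahn_decomposition nu.
have [[mP _] [mN _] PNT PN0] := nuPN.
have fin (m : probability X R) A B : measurable A -> measurable B -> m (A `&` B) \is a fin_num.
  by move=> mA mB; apply: fin_num_measure; exact: measurableI.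
have split_PN (m : probability X R) A : measurable A -> m A = (m (A `&` N) + m (A `&` P))%E.
  move=> mA; rewrite addeC -[in LHS](setIT A) -PNT setIUr measureU//; [exact: measurableI..|].
  by rewrite setIACA PN0 setI0.
pose m : {measure set X -> \bar R} := measure_add (mrestr m1 mN) (mrestr m2 mP).
have mE A : m A = (m1 (A `&` N) + m2 (A `&` P))%E by exact: measure_addE.
pose n1 : {finite_measure set X -> \bar R} := jordan_pos nuPN.
pose n2 : {finite_measure set X -> \bar R} := jordan_neg nuPN.
have n1E A : measurable A -> n1 A = (m1 (A `&` P) - m2 (A `&` P))%E.
  by move=> mA; rewrite [LHS]jordan_posE cjordan_posE /crestr0 mem_set// /crestr nuE.
have n2E A : measurable A -> n2 A = (m2 (A `&` N) - m1 (A `&` N))%E.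
  move=> mA; rewrite [LHS]jordan_negE cjordan_negE /crestr0 mem_set// /crestr nuE.
  by rewrite fin_num_oppeB ?fin// addeC.
have m1E A : measurable A -> m1 A = (m A + n1 A)%E.
  move=> mA; rewrite split_PN// mE n1E// -addeA; congr (_ + _)%E.
  by rewrite addeC subeK ?fin.
have m2E A : measurable A -> m2 A = (m A + n2 A)%E.
  move=> mA; rewrite split_PN// mE n2E// addeAC; congr (_ + _)%E.
  by rewrite addeC subeK ?fin.
exists P, m, n1, n2; split => //; split; first by rewrite n1E// setTI.
have mT_fin : m setT \is a fin_num by rewrite mE fin_numD !fin.
by rewrite -[LHS](addeK _ mT_fin) -[RHS](addeK _ mT_fin)
    [X in (X - _)%E = _]addeC [X in _ = (X - _)%E]addeC -m2E// -m1E// !probability_setT.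
Qed.

Lemma expect_le_sets (m1 m2 : probability X R) (e : R) f : unit_fun f ->
  (forall A, measurable A -> expect m1 \1_A <= expect m2 \1_A + e) ->
  expect m1 f <= expect m2 f + e.
Proof.
move=> uf m12; have [P [m [n1 [n2 [mP m1E m2E [n1T _]]]]]] := common_part m1 m2.
have mf : measurable_fun setT (EFin \o f) by exact/measurable_EFinP/measurable_unit_fun.
have f0 x : setT x -> (0 <= (f x)%:E)%E by rewrite lee_fin unit_fun_ge0.
have split_int (m' : probability X R) (n : {finite_measure set X -> \bar R}) :
    (forall A, measurable A -> m' A = (m A + n A)%E) ->
    (\int[m']_x (f x)%:E = \int[m]_x (f x)%:E + \int[n]_x (f x)%:E)%E.
  move=> m'E; rewrite -ge0_integral_measure_add//; apply: eq_measure_integral => A mA _.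
  by rewrite [RHS]measure_addE -m'E.
rewrite -lee_fin EFinD !EFin_expect// (split_int _ _ m1E) (split_int _ _ m2E) -addeA.
apply: leeD => //; apply: (@le_trans _ _ (n1 setT)).
  rewrite -[leRHS]mul1e -integral_cst//; apply: ge0_le_integral => //.
  by move=> x _; rewrite lee_fin unit_fun_le1.
apply: (@le_trans _ _ e%:E); last by rewrite leeDr// integral_ge0.
by rewrite n1T -!expect_indic// -EFinB lee_fin lerBlDl m12.
Qed.

End Hahn.

Section TotalVariation.
Context {R : realType} {d : measure_display} {X : measurableType d}.
Implicit Types (m : probability X R) (A : set X) (e : R).

Definition tv_close e m1 m2 : Prop :=
  forall f, unit_fun f -> `|expect m1 f - expect m2 f| <= e.

Lemma tv_close_trans m2 e1 e2 m1 m3 :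
  tv_close e1 m1 m2 -> tv_close e2 m2 m3 -> tv_close (e1 + e2) m1 m3.
Proof.
move=> m12 m23 f uf; apply: le_trans (ler_distD (expect m2 f) _ _) _.
by apply: lerD; [exact: m12 | exact: m23].
Qed.

Lemma tv_close_sets e m1 m2 :
  (forall A, measurable A -> `|expect m1 \1_A - expect m2 \1_A| <= e) -> tv_close e m1 m2.
Proof.
move=> m12 f uf; rewrite ler_distl lerBlDr; apply/andP; split;
  apply: expect_le_sets => // A /m12; rewrite ler_distl lerBlDr; by case/andP.
Qed.

End TotalVariation.

Section UniformLimit.
Context {R : realType} {d : measure_display} {X : measurableType d}.
Context {I : Type} (F : set_system I) {FF : ProperFilter F}.
Variables (p : I -> probability X R) (l : set X -> R).
Hypothesis p_l : forall e : R, 0 < e -> \forall i \near F,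
  forall A, measurable A -> `|expect (p i) \1_A - l A| <= e.

Let cvg_l A : measurable A -> expect (p i) \1_A @[i --> F] --> l A.
Proof.
move=> mA; apply/cvgrPdist_le => e /p_l; apply: filterS => i /(_ A mA).
by rewrite distrC.
Qed.

Let l_cst A (c : R) : measurable A -> (forall i, expect (p i) \1_A = c) -> l A = c.
Proof.
move=> mA pAc; rewrite -(cvg_lim _ (cvg_l mA))//.
by under eq_fun do rewrite pAc; exact: lim_cst.
Qed.

Let l_ge0 A : measurable A -> 0 <= l A.
Proof.
move=> mA; rewrite -(cvg_lim _ (cvg_l mA))//; apply: limr_ge.
  by apply/cvg_ex; exists (l A); exact: cvg_l.
by apply: nearW => i; exact/expect_ge0/unit_fun_indic.
Qed.

Let l_setU A B : measurable A -> measurable B -> [disjoint A & B] -> l (A `|` B) = l A + l B.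
Proof.
move=> mA mB AB; rewrite -(cvg_lim _ (cvg_l (measurableU _ _ mA mB)))//; apply: cvg_lim => //.
under eq_fun do rewrite expect_indicU//.
by apply: cvgD; exact: cvg_l.
Qed.

Let l_bigcup (A : nat -> set X) : (forall n, measurable (A n)) ->
  l (\big[setU/set0]_(i < n) A i) @[n --> \oo] --> l (\bigcup_n A n).
Proof.
move=> mA; apply/cvgrPdist_le => e e0; have e30 : 0 < e / 3 by rewrite divr_gt0.
have [i p_i] := filter_ex (p_l e30).
have /cvgrPdist_le/(_ _ e30) := expect_indic_bigcup (m := p i) mA.
apply: filterS => n; rewrite !ler_distl.
have mU : measurable (\big[setU/set0]_(k < n) A k) by exact: bigsetU_measurable.
have := p_i _ (bigcupT_measurable _ mA); have := p_i _ mU.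
by rewrite !ler_distl; lra.
Qed.

Lemma uniform_limit_probability :
  exists mu : probability X R, forall A, measurable A -> expect mu \1_A = l A.
Proof.
pose m A : \bar R := (`|l A|)%:E.
have mE A : measurable A -> m A = (l A)%:E by move=> mA; rewrite /m ger0_norm// l_ge0.
have m0 : m set0 = 0%E by rewrite mE// (@l_cst _ 0)// => i; exact: expect_indic0.
have m_ge0 A : (0 <= m A)%E by rewrite lee_fin.
have m_sigma : semi_sigma_additive m.
  move=> A mA /trivIsetP tA mUA; rewrite mE//.
  rewrite (_ : (fun n => _) = (fun n => (l (\big[setU/set0]_(i < n) A i))%:E)).
    by apply: cvg_EFin; [exact: nearW | exact: l_bigcup].
  apply/funext; elim=> [|n IH].
    by rewrite big_geq// big_ord0 -mE// m0.
  rewrite big_nat_recr//= IH mE// -EFinD big_ord_recr/= l_setU//; first exact: bigsetU_measurable.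
  apply/disj_set2P; rewrite -bigcup_mkord setI_bigcupl; apply: bigcup0 => k /= kn.
  by apply: tA => //; rewrite ltn_eqF.
pose mu1 : measure _ _ := HB.pack m (isMeasure.Build _ _ _ m m0 m_ge0 m_sigma).
have mu1T : mu1 setT = 1%E by rewrite /mu1/= mE// (@l_cst _ 1)// => i; exact: expect_indicT.
pose mu : probability X R := HB.pack m mu1 (Measure_isProbability.Build _ _ _ mu1 mu1T).
by exists mu => A mA; apply: EFin_inj; rewrite expect_indic// -mE.
Qed.

End UniformLimit.

Lemma tv_complete (R : realType) d (X : measurableType d) I (F : set_system I)
    {FF : ProperFilter F} (p : I -> probability X R) :
  (forall e : R, 0 < e -> \forall i \near F, \forall j \near F, tv_close e (p i) (p j)) ->
  exists mu, forall e : R, 0 < e -> \forall i \near F, tv_close e (p i) mu.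
Proof.
move=> p_cauchy; pose l A : R := lim (expect (p i) \1_A @[i --> F]).
have cvg_l A : measurable A -> expect (p i) \1_A @[i --> F] --> l A.
  move=> mA; apply/cauchy_cvgP/cauchy_exP => e e0.
  have [|i p_i] := filter_ex (p_cauchy (e / 2) _); first by rewrite divr_gt0.
  exists (expect (p i) \1_A); apply: filterS p_i => j /(_ _ (unit_fun_indic mA)).
  by rewrite -ball_normE/= => /le_lt_trans; apply; rewrite ltr_pdivrMr// ltr_pMr// ltr1n.
have p_l (e : R) : 0 < e -> \forall i \near F,
    forall A, measurable A -> `|expect (p i) \1_A - l A| <= e.
  move=> /p_cauchy; apply: filterS => i p_i A mA.
  have cvg_dist : `|expect (p i) \1_A - expect (p j) \1_A| @[j --> F] -->
      `|expect (p i) \1_A - l A|.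
    by apply: cvg_norm; apply: cvgB; [exact: cvg_cst | exact: cvg_l].
  rewrite -(cvg_lim _ cvg_dist)//; apply: limr_le; first by apply/cvg_ex; eexists; exact: cvg_dist.
  by apply: filterS p_i => j /(_ _ (unit_fun_indic mA)).
have [mu muE] := uniform_limit_probability p_l.
exists mu => e /p_l; apply: filterS => i p_i; apply: tv_close_sets => A mA.
by rewrite muE//; exact: p_i.
Qed.

(** * Polish metrics *)

Section Metric.
Context {R : realType} {X : Type} (rho : X -> X -> R).
Hypothesis rho_metric : is_metric rho.
Implicit Types (f g : X -> R) (x y z : X) (F U : set X).

Let rho_ge0 x y : 0 <= rho x y. Proof. by case: rho_metric. Qed.
Let rhoC x y : rho x y = rho y x. Proof. by case: rho_metric. Qed.
Let rhoxx x : rho x x = 0. Proof. by case: rho_metric => _ rho0 _ _; apply/rho0. Qed.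
Let rhoD y x z : rho x z <= rho x y + rho y z. Proof. by case: rho_metric. Qed.

Lemma rball_center z (r : R) : 0 < r -> rball rho z r z.
Proof. by rewrite /rball/= rhoxx. Qed.

Lemma ropen_rball z (r : R) : ropen rho (rball rho z r).
Proof.
move=> x; rewrite /rball/= => zx; exists (r - rho z x); split; first by rewrite subr_gt0.
by move=> y /= xy; have := rhoD x z y; lra.
Qed.

Lemma ropenI : setI_closed (ropen rho).
Proof.
move=> A B oA oB x [Ax Bx].
have [r [r0 rA]] := oA x Ax; have [s [s0 sB]] := oB x Bx.
exists (Num.min r s); split; first by rewrite lt_min r0.
by move=> y /=; rewrite /rball/= lt_min => /andP[xr xs]; split; [exact: rA | exact: sB].
Qed.

Lemma separable_base :
  (exists D : nat -> X, forall x (e : R), 0 < e -> exists n, rho x (D n) < e) ->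
  exists B : nat -> set X, (forall n, ropen rho (B n)) /\
    forall x (r : R), 0 < r -> exists n, B n x /\ B n `<=` rball rho x r.
Proof.
move=> [D denseD]; pose ball (p : nat * nat) := rball rho (D p.1) p.2.+1%:R^-1.
exists (fun n => oapp ball set0 (unpickle n)); split=> [n|x r r0].
  by case: unpickle => [p|]/=; [exact: ropen_rball | move=> x].
have [k _ kr] := near_infty_natSinv_lt (PosNum (divr_gt0 r0 (ltr0n R 2))).
have {}kr : k.+1%:R^-1 < r / 2 :> R by exact: (kr k (leqnn _)).
have [|n xD] := denseD x k.+1%:R^-1; first by rewrite invr_gt0 ltr0n.
exists (pickle (n, k)); rewrite pickleK /= /ball /rball /=; split; first by rewrite rhoC.
move=> y /= Dy; apply: le_lt_trans (rhoD (D n) x y) _; rewrite (splitr r).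
by apply: ltrD; [exact: lt_trans xD kr | exact: lt_trans Dy kr].
Qed.

Lemma rcontinuous_cst (c : R) : rcontinuous rho (fun=> c).
Proof. by move=> x e e0; exists 1; split => // y _; rewrite subrr normr0. Qed.

Lemma rcontinuous_lipschitz f (L : R) :
  (forall x y, `|f y - f x| <= L * rho x y) -> rcontinuous rho f.
Proof.
move=> fL x e e0; have L0 : 0 < `|L| + 1 by rewrite ltr_wpDl.
exists (e / (`|L| + 1)); split; first by rewrite divr_gt0.
move=> y; rewrite ltr_pdivlMr// => xy.
apply: le_lt_trans (fL x y) _; apply: le_lt_trans xy.
by rewrite mulrC ler_wpM2l//; have := ler_norm L; lra.
Qed.

Lemma rcontinuous_cvg f x (v : nat -> X) : rcontinuous rho f ->
  (forall e : R, 0 < e -> \forall n \near \oo, rho x (v n) < e) -> f (v n) @[n --> \oo] --> f x.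
Proof.
move=> cf v_x; apply/cvgrPdist_lt => e e0; have [r [r0 fr]] := cf x e e0.
by apply: filterS (v_x r r0) => n /fr; rewrite distrC.
Qed.

Lemma sequentially_rcontinuous f :
  (forall x (v : nat -> X), (forall e : R, 0 < e -> \forall n \near \oo, rho x (v n) < e) ->
    f (v n) @[n --> \oo] --> f x) -> rcontinuous rho f.
Proof.
move=> seqf x e e0; apply: contrapT => discontinuous.
have witness (n : nat) : exists y, rho x y < n.+1%:R^-1 /\ e <= `|f y - f x|.
  apply: contrapT => noy; apply: discontinuous; exists n.+1%:R^-1.
  split=> [|y xy]; first by rewrite invr_gt0 ltr0n.
  by rewrite ltNge; apply/negP => far; apply: noy; exists y.
have [v v_far] := choice witness.
have /cvgrPdist_lt/(_ e e0)/filter_ex[n] : f (v n) @[n --> \oo] --> f x.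
  apply: seqf => r r0; have := near_infty_natSinv_lt (PosNum r0).
  by apply: filterS => n; apply: lt_trans; case: (v_far n).
by rewrite distrC ltNge; case: (v_far n) => _ ->.
Qed.

Lemma rcontinuous1B f : rcontinuous rho f -> rcontinuous rho (fun x => 1 - f x).
Proof.
move=> cf x e e0; have [r [r0 fr]] := cf x e e0; exists r; split => // y /fr.
by rewrite -normrN; congr (`|_| < _); lra.
Qed.

Lemma rcontinuous_max f g : rcontinuous rho f -> rcontinuous rho g ->
  rcontinuous rho (fun x => Num.max (f x) (g x)).
Proof.
move=> cf cg x e e0; have [r [r0 fr]] := cf x e e0; have [s [s0 gs]] := cg x e e0.
exists (Num.min r s); split; first by rewrite lt_min r0.
move=> y; rewrite lt_min => /andP[/fr+ /gs].
by rewrite !ltr_norml; case: (leP (f y) (g y)); case: (leP (f x) (g x)); lra.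
Qed.

Definition dist_to F x : R := inf [set rho x y | y in F].

Lemma dist_to_le F x y : F y -> dist_to F x <= rho x y.
Proof. by move=> Fy; apply: ge_inf; [exists 0 => _ [w _ <-] | exists y]. Qed.

Lemma le_dist_to F x (r : R) : F !=set0 -> rball rho x r `<=` ~` F -> r <= dist_to F x.
Proof.
move=> [a Fa] xrF; apply: lb_le_inf; first by exists (rho x a), a.
by move=> _ [y Fy <-]; rewrite leNgt; apply/negP => /xrF.
Qed.

Lemma dist_to_ge0 F x : F !=set0 -> 0 <= dist_to F x.
Proof. by move=> F0; apply: le_dist_to => // y; rewrite /rball/= ltNge rho_ge0. Qed.

Lemma dist_to_eq0 F x : F x -> dist_to F x = 0.
Proof.
move=> Fx; apply/eqP; rewrite eq_le dist_to_ge0; last by exists x.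
by rewrite -(rhoxx x) dist_to_le.
Qed.

Lemma dist_to_lip F x y : F !=set0 -> `|dist_to F y - dist_to F x| <= rho x y.
Proof.
move=> [a Fa]; have lip u v : dist_to F u <= rho u v + dist_to F v.
  rewrite -lerBlDl; apply: lb_le_inf; first by exists (rho v a), a.
  by move=> _ [b Fb <-]; rewrite lerBlDl (le_trans (dist_to_le _ Fb)).
by have := lip x y; have := lip y x; rewrite (rhoC y x) ler_norml; lra.
Qed.

Lemma ropen_approx U : ropen rho U -> exists g : nat -> X -> R,
  [/\ forall n, rcontinuous rho (g n), forall n x, 0 <= g n x <= \1_U x &
      forall x, g ^~ x @ \oo --> (\1_U x : R)].
Proof.
move=> oU; have [UT|/set0P F0] := eqVneq (~` U) set0.
  have -> : U = setT by rewrite -(setCK U) UT setC0.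
  exists (fun _ => \1_setT); split => [_|_ x|x]; last exact: cvg_cst.
  - by rewrite indicT; exact: rcontinuous_cst.
  - by rewrite indicT ler01 lexx.
pose g n x : R := Num.min 1 (n%:R * dist_to (~` U) x).
have gU n x : x \notin U -> g n x = 0.
  by rewrite notin_setE => nUx; rewrite /g dist_to_eq0// mulr0; apply/min_idPr.
exists g; split => [n|n x|x].
- apply: (@rcontinuous_lipschitz _ n%:R) => x y.
  have : `|n%:R * dist_to (~` U) y - n%:R * dist_to (~` U) x| <= n%:R * rho x y.
    by rewrite -mulrBr normrM ger0_norm// ler_wpM2l// dist_to_lip.
  by rewrite /g !ler_norml; case: (leP 1 (_ * dist_to _ x));
    case: (leP 1 (_ * dist_to _ y)); lra.
- rewrite indicE; case: (boolP (x \in U)) => [_|/gU->]; last by rewrite lexx.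
  by rewrite le_min ler01 mulr_ge0 ?dist_to_ge0//= ge_min lexx.
- rewrite indicE; case: (boolP (x \in U)) => [/set_mem Ux|nUx]; last first.
    by under eq_fun do rewrite gU//; exact: cvg_cst.
  have [r [r0 rU]] := oU x Ux; have dr : r <= dist_to (~` U) x by rewrite le_dist_to// setCK.
  apply: cvg_near_cst; near=> n; apply/min_idPl.
  apply: le_trans (ler_wpM2l _ dr) => //.
  by rewrite -ler_pdivrMr// mul1r; near: n; exact: nbhs_infty_ger.
Unshelve. all: by end_near. Qed.

End Metric.

Section Borel.
Context {R : realType} {d : measure_display} {X : measurableType d} (rho : X -> X -> R).
Hypothesis rho_metric : is_metric rho.
Hypothesis borel : @measurable d X = <<s ropen rho >>.
Implicit Types (f : X -> R) (U : set X).

Lemma ropen_measurable U : ropen rho U -> measurable U.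
Proof. by move=> oU; rewrite borel; exact: sub_gen_smallest. Qed.

Lemma measurable_rball x (r : R) : measurable (rball rho x r).
Proof. by apply: ropen_measurable; exact: ropen_rball. Qed.

Lemma rcontinuous_measurable f : rcontinuous rho f -> measurable_fun setT f.
Proof.
move=> cf; apply: (measurability _ (RGenOInfty.measurableE R)) => _ [_ [a ->] <-].
rewrite setTI; apply: ropen_measurable => x /=; rewrite in_itv/= andbT => ax.
have [|r [r0 fr]] := cf x (f x - a); first by rewrite subr_gt0.
by exists r; split => // y /fr; rewrite ltr_norml /= in_itv/= andbT; lra.
Qed.

Lemma ropen_approx_unit U : ropen rho U -> exists g : nat -> X -> R,
  [/\ forall n, rcontinuous rho (g n), forall n, unit_fun (g n),
      forall n x, g n x <= \1_U x & forall x, g ^~ x @ \oo --> (\1_U x : R)].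
Proof.
move=> oU; have [g [cg g01 gU]] := ropen_approx rho_metric oU; exists g; split => // [n|n x].
  split; first exact: rcontinuous_measurable.
  move=> x; have /andP[-> /= gx] := g01 n x.
  by apply: le_trans gx _; exact/unit_fun_le1/unit_fun_indic/ropen_measurable.
by case/andP: (g01 n x).
Qed.

End Borel.

Section Separable.
Context {R : realType} {d : measure_display} {X : measurableType d} (rho : X -> X -> R).
Hypothesis rho_polish : polish rho.
Hypothesis borel : @measurable d X = <<s ropen rho >>.

Let rho_metric : is_metric rho. Proof. by case: rho_polish. Qed.

Let base : exists B : nat -> set X, (forall n, ropen rho (B n)) /\
  forall x (r : R), 0 < r -> exists n, B n x /\ B n `<=` rball rho x r.
Proof. by apply: separable_base => //; case: rho_polish. Qed.

Lemma measurable_offdiag : measurable [set p : X * X | p.1 <> p.2].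
Proof.
have [B [oB baseB]] := base; have [rho_ge0 rho0 _ _] := rho_metric.
rewrite (_ : [set _ | _] = \bigcup_n (B n `*` ~` B n)).
  apply: bigcupT_measurable => n.
  by apply: measurableX; [|apply: measurableC]; exact: (ropen_measurable borel).
apply/seteqP; split => -[x y] /=; last first.
  by move=> [n _ [Bx nBy]] xy; apply: nBy; rewrite -xy.
move=> xy; have r0 : 0 < rho x y.
  by rewrite lt_neqAle rho_ge0 andbT eq_sym; apply/eqP => /rho0.
have [n [Bx Br]] := baseB x _ r0; exists n => //; split=> // /Br.
by rewrite /rball/= ltxx.
Qed.

(* Lindelöf: countably many null basic sets cover [N]. *)
Lemma null_balls_negligible (m : {measure set X -> \bar R}) (N : set X) :
  (forall x, N x -> exists2 r : R, 0 < r & m (rball rho x r) = 0%E) -> m.-negligible N.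
Proof.
move=> nullN; have [B [oB baseB]] := base.
have mB n : measurable (B n) by exact: (ropen_measurable borel).
apply: (@negligibleS _ _ _ _ (\bigcup_n (if m (B n) == 0%E then B n else set0))).
  move=> x /nullN[r r0 mr0]; have [n [Bx Br]] := baseB x r r0; exists n => //.
  rewrite ifT// -measure_le0 -mr0 le_measure// inE//.
  exact: (measurable_rball rho_metric borel).
apply: negligible_bigcup => n; case: ifPn => [/eqP mB0|_]; last exact: negligible_set0.
exact/negligibleP.
Qed.

Lemma exists_supporting_point (m : probability X R) :
  exists z, forall r : R, 0 < r -> 0 < expect m \1_(rball rho z r).
Proof.
apply: contrapT => noz.
suff null : m.-negligible [set: X].
  have : m setT = 0%E by exact/negligibleP.
  by rewrite probability_setT => /eqP; rewrite onee_eq0.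
apply: null_balls_negligible => x _; apply: contrapT => posx; apply: noz; exists x => r r0.
have mr := measurable_rball rho_metric borel x r.
rewrite lt_neqAle expect_ge0 ?andbT; last exact: unit_fun_indic.
by apply/eqP => m0; apply: posx; exists r => //; rewrite -[LHS](expect_indic m mr) -m0.
Qed.

End Separable.

Lemma ler_dist_max (R : realDomainType) (a b a' b' : R) :
  `|Num.max a b - Num.max a' b'| <= `|a - a'| + `|b - b'|.
Proof.
have := ler_norm (a - a'); have := ler_norm (a' - a); rewrite (distrC a').
have := ler_norm (b - b'); have := ler_norm (b' - b); rewrite (distrC b').
have := normr_ge0 (a - a'); have := normr_ge0 (b - b').
by rewrite ler_norml; case: (leP a b); case: (leP a' b'); lra.
Qed.

Lemma indicU (R : realDomainType) T (A B : set T) x :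
  \1_(A `|` B) x = Num.max (\1_A x) (\1_B x) :> R.
Proof.
rewrite !indicE in_setU; case: (x \in A); case: (x \in B) => //=; rewrite ?maxxx//.
  by rewrite (max_idPl ler01).
by rewrite (max_idPr ler01).
Qed.

Section Density.
Context {R : realType} {d : measure_display} {X : measurableType d} (rho : X -> X -> R).
Hypothesis rho_metric : is_metric rho.
Hypothesis borel : @measurable d X = <<s ropen rho >>.
Variables m1 m2 : probability X R.
Implicit Types (f g h : X -> R) (A B : set X).

Let L1 f g : R := expect m1 (fun x => `|f x - g x|) + expect m2 (fun x => `|f x - g x|).

Let L1_trans g f h : unit_fun f -> unit_fun g -> unit_fun h -> L1 f h <= L1 f g + L1 g h.
Proof.
by move=> uf ug uh; rewrite /L1 addrACA; apply: lerD; exact: expect_dist_trans.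
Qed.

Let L1_cvg (f_ : nat -> X -> R) f : (forall n, unit_fun (f_ n)) -> unit_fun f ->
  (forall x, f_ ^~ x @ \oo --> f x) -> L1 f (f_ n) @[n --> \oo] --> 0.
Proof.
move=> uf_ uf ff.
have cvg0 (m : probability X R) : expect m (fun x => `|f x - f_ n x|) @[n --> \oo] --> 0.
  rewrite -(expect_cst m 0); apply: expect_cvg => [n||x]; [exact: unit_fun_dist|exact: unit_fun0|].
  by rewrite -(normr0 R) -(subrr (f x)); apply: cvg_norm; apply: cvgB => //; exact: cvg_cst.
by rewrite -(addr0 0); exact: cvgD.
Qed.

Let approximable f := forall e : R, 0 < e ->
  exists g, [/\ rcontinuous rho g, unit_fun g & L1 f g <= e].

Let approximable_cont f : unit_fun f -> rcontinuous rho f -> approximable f.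
Proof.
move=> uf cf e e0; exists f; split => //.
have dist0 (m : probability X R) : expect m (fun x => `|f x - f x|) = 0.
  by under eq_Rintegral do rewrite subrr normr0; rewrite expect_cst.
by rewrite /L1 !dist0 addr0 ltW.
Qed.

Let approximable_cvg (f_ : nat -> X -> R) f : (forall n, unit_fun (f_ n)) -> unit_fun f ->
  (forall x, f_ ^~ x @ \oo --> f x) -> (forall n, approximable (f_ n)) -> approximable f.
Proof.
move=> uf_ uf ff af_ e e0; have e20 : 0 < e / 2 by rewrite divr_gt0.
have /cvgr0Pnorm_lt/(_ _ e20)/filter_ex[n fn] := L1_cvg uf_ uf ff.
have [g [cg ug fg]] := af_ n _ e20; exists g; split => //.
apply: le_trans (L1_trans uf (uf_ n) ug) _; rewrite [leRHS]splitr.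
by apply: lerD => //; apply/ltW/(le_lt_trans (ler_norm _)).
Qed.

Let approximable_indicU A B : measurable A -> measurable B ->
  approximable \1_A -> approximable \1_B -> approximable \1_(A `|` B).
Proof.
move=> mA mB aA aB e e0; have e20 : 0 < e / 2 by rewrite divr_gt0.
have [f [cf uf Af]] := aA _ e20; have [g [cg ug Bg]] := aB _ e20.
have uA := unit_fun_indic (R := R) mA; have uB := unit_fun_indic (R := R) mB.
have uAB := unit_fun_indic (R := R) (measurableU _ _ mA mB); have ufg := unit_fun_max uf ug.
exists (fun x => Num.max (f x) (g x)); split => //; first exact: rcontinuous_max.
have le_sum (m : probability X R) : expect m (fun x => `|\1_(A `|` B) x - Num.max (f x) (g x)|) <=
    expect m (fun x => `|\1_A x - f x|) + expect m (fun x => `|\1_B x - g x|).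
  rewrite -[leRHS]mul1r mulrDr; apply: le_expect_lin => [|||x]; [exact: unit_fun_dist..|].
  by rewrite !mul1r indicU; exact: ler_dist_max.
by rewrite [leRHS]splitr; apply: le_trans (lerD Af Bg); rewrite /L1 addrACA lerD.
Qed.

Let approximable_indic A : measurable A -> approximable \1_A.
Proof.
rewrite {1}borel; move: A; apply: (@dynkin_induction _ _ (ropen rho)) => //.
- exact: ropenI.
- by rewrite indicT; apply: approximable_cont; [exact: unit_fun1 | exact: rcontinuous_cst].
- move=> U oU; have [g [cg ug _ gU]] := ropen_approx_unit rho_metric borel oU.
  apply: (approximable_cvg ug _ gU) => [|n]; last exact: approximable_cont.
  exact/unit_fun_indic/(ropen_measurable borel).
- move=> A mA aA e e0; have [g [cg ug Ag]] := aA e e0.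
  exists (fun x => 1 - g x); split; [exact: rcontinuous1B | exact: unit_fun1B |].
  rewrite (_ : L1 _ _ = L1 \1_A g)//; congr (_ + _); apply: eq_Rintegral => x _;
    rewrite !indicE in_setC -normrN; case: (_ \in _) => /=; congr `|_|; lra.
- move=> F mF _ aF; have mU n : measurable (\big[setU/set0]_(i < n) F i).
    exact: bigsetU_measurable.
  apply: (approximable_cvg (fun n => unit_fun_indic (mU n))).
  + exact/unit_fun_indic/bigcupT_measurable.
  + exact: indic_bigcup_cvg.
  elim=> [|n IH]; last first.
    by rewrite big_ord_recr/=; exact: (approximable_indicU (mU n) (mF n) IH (aF n)).
  by rewrite big_ord0 indic0; apply: approximable_cont; [exact: unit_fun0 | exact: rcontinuous_cst].
Qed.

Lemma tv_close_continuous (e : R) :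
  (forall g, rcontinuous rho g -> unit_fun g -> `|expect m1 g - expect m2 g| <= e) ->
  tv_close e m1 m2.
Proof.
move=> m12; apply: tv_close_sets => A mA; apply/ler_addgt0Pr => eta eta0.
have uA := unit_fun_indic (R := R) mA.
have [g [cg ug Ag]] := approximable_indic mA eta0.
have := expect_dist m1 uA ug; have := expect_dist m2 uA ug; have := m12 g cg ug.
by move: Ag; rewrite /L1 !ler_distl; lra.
Qed.

End Density.

Section Baire.
Context {R : realType} {X : choiceType} (rho : X -> X -> R).
Hypothesis rho_polish : polish rho.

Lemma nested_closed_balls (c : nat -> X) (s : nat -> R) :
  (forall n, 0 <= s n) -> s n @[n --> \oo] --> 0 ->
  (forall n y, rho (c n.+1) y <= s n.+1 -> rho (c n) y <= s n) ->
  exists l, forall n, rho (c n) l <= s n.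
Proof.
move=> s_ge0 s_cvg0 nested; have [[_ rho0 rhoC rhoD] complete _] := rho_polish.
have nested_add n k y : rho (c (k + n)%N) y <= s (k + n)%N -> rho (c n) y <= s n.
  by elim: k => [//|k IH] /nested.
have center n m : (n <= m)%N -> rho (c n) (c m) <= s n.
  move=> nm; apply: (nested_add n (m - n)%N); rewrite subnK//.
  by rewrite (rho0 _ _).2.
have [|l c_l] := complete c.
  move=> e e0; have e20 : 0 < e / 2 by rewrite divr_gt0.
  have /cvgr0Pnorm_lt/(_ _ e20)[N _ sN] := s_cvg0.
  have {}sN : s N < e / 2 by apply: le_lt_trans (ler_norm _) (sN N (leqnn _)).
  exists N => m n Nm Nn; rewrite (splitr e); apply: le_lt_trans (rhoD _ (c N) _) _.
  by rewrite (rhoC _ (c N)); apply: ltrD; apply: le_lt_trans (center _ _ _) sN.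
exists l => n; apply/ler_addgt0Pr => e e0; have [N c_le] := c_l e e0.
have := c_le _ (leq_maxl N n); have := center _ _ (leq_maxr N n).
by have := rhoD (c n) (c (maxn N n)) l; lra.
Qed.

Lemma baire_relative (F : nat -> set X) (Y : set X) z : Y z ->
  (forall n, ropen rho (~` F n)) -> (forall x, exists n, F n x) ->
  exists n x (r : R), [/\ 0 < r, Y x & forall y, Y y -> rball rho x r y -> F n y].
Proof.
move=> Yz oF coverF; apply: contrapT => noball.
have [[_ _ _ rhoD] _ _] := rho_polish.
pose shrinks n (p q : X * R) := [/\ Y q.1, 0 < q.2, q.2 <= n.+1%:R^-1 &
  forall w, rho q.1 w <= q.2 -> rho p.1 w <= p.2 /\ ~ F n w].
have shrink n (p : X * R) : exists q, Y p.1 -> 0 < p.2 -> shrinks n p q.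
  case: p => x r /=; have [[Yx r0]|nYr] := pselect (Y x /\ 0 < r); last first.
    by exists (x, r) => Yx r0; case: nYr.
  have [y [Yy xy nFy]] : exists y, [/\ Y y, rho x y < r & ~ F n y].
    apply: contrapT => noy; apply: noball; exists n, x, r; split => // y Yy xy.
    by apply: contrapT => nFy; apply: noy; exists y.
  have [s [s0 sF]] := oF n y nFy; have rxy : 0 < r - rho x y by rewrite subr_gt0.
  exists (y, Num.min (Num.min (s / 2) (r - rho x y)) n.+1%:R^-1) => _ _; split => //=.
  - by rewrite !lt_min divr_gt0// rxy invr_gt0 ltr0n.
  - by rewrite ge_min lexx orbT.
  - move=> w; rewrite !le_min => /andP[/andP[ws wr] _]; split.
      by have := rhoD x y w; lra.
    by apply: sF; rewrite /rball/=; lra.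
have [q qP] := choice (fun np : nat * (X * R) => shrink np.1 np.2).
pose u := fix u n : X * R := if n is k.+1 then q (k, u k) else (z, 1).
have uY n : Y (u n).1 /\ 0 < (u n).2.
  by elim: n => [//|n [Yn rn]]; have [] := qP (n, u n) Yn rn.
have uS n : shrinks n (u n) (u n.+1) by have [Yn rn] := uY n; exact: qP (n, u n) Yn rn.
have [n||n y|l ul] := @nested_closed_balls (fun n => (u n).1) (fun n => (u n).2).
- by apply/ltW; case: (uY n).
- rewrite -cvg_shiftS /=.
  apply: (@squeeze_cvgr _ _ _ _ (fun=> 0) (fun n => n.+1%:R^-1)).
  + by apply: nearW => n; case: (uS n) => _ /ltW -> ->.
  + exact: cvg_cst.
  + exact: cvg_harmonic.
- by case: (uS n) => _ _ _ un /un[].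
- by have [n Fl] := coverF l; have [_ _ _ /(_ l (ul n.+1))[_]] := uS n.
Qed.

End Baire.

(** * Convergence of averages in total variation *)

Section Frequently.
Context {R : realType}.
Implicit Types P Q : R -> Prop.

Definition frequently P : Prop := forall T0 : R, exists2 T, T0 <= T & P T.

Lemma sub_frequently P Q : (forall T, P T -> Q T) -> frequently P -> frequently Q.
Proof. by move=> PQ freqP T0; have [T T0T PT] := freqP T0; exists T => //; exact: PQ. Qed.

Lemma frequently_near P Q :
  frequently P -> (\forall T \near +oo, Q T) -> frequently (fun T => P T /\ Q T).
Proof.
move=> freqP [M [_ Qgt]] T0; have [T] := freqP (Num.max T0 (M + 1)).
rewrite ge_max => /andP[T0T MT] PT; exists T => //; split => //; apply: Qgt.
by apply: lt_le_trans MT; rewrite ltrDl.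
Qed.

Lemma frequently_ex P : frequently P -> exists T, P T.
Proof. by move=> /(_ 0)[T _ PT]; exists T. Qed.

Lemma not_near_frequently P : ~ (\forall T \near +oo, P T) -> frequently (fun T => ~ P T).
Proof.
move=> notnear T0; apply: contrapT => noT; apply: notnear; exists T0; split; first exact: num_real.
by move=> T T0T; apply: contrapT => nPT; apply: noT; exists T => //; exact: ltW.
Qed.

Lemma near_div_le (t e : R) : 0 < e -> \forall T \near +oo, t / T <= e.
Proof.
move=> e0; near=> T; have T0 : 0 < T by near: T; exact: nbhs_pinfty_gt.
rewrite ler_pdivrMr// mulrC -ler_pdivrMr//.
Unshelve. all: by end_near. Qed.

End Frequently.

Definition tv_limit {R : realType} {d} {X : measurableType d} (Q : R -> X -> probability X R)
    (mu : probability X R) : Prop :=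
  forall x (e : R), 0 < e -> \forall T \near +oo, tv_close e (Q T x) mu.

Section Averages.
Context {R : realType} {d : measure_display} {X : measurableType d} (rho : X -> X -> R).
Hypothesis rho_polish : polish rho.
Hypothesis borel : @measurable d X = <<s ropen rho >>.

Let rho_metric : is_metric rho. Proof. by case: rho_polish. Qed.

Variable Q : R -> X -> probability X R.
Hypothesis measurable_Q : forall T A, measurable A -> measurable_fun setT (fun y => Q T y A).
Hypothesis Q_comm : forall (S T : R) x f, 0 < S -> 0 < T -> unit_fun f ->
  expect (Q S x) (fun y => expect (Q T y) f) = expect (Q T x) (fun y => expect (Q S y) f).
Hypothesis Q_shift : forall (S T : R) x f, 0 < S -> 0 < T -> unit_fun f ->
  `|expect (Q S x) (fun y => expect (Q T y) f) - expect (Q S x) f| <= T / S.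
Hypothesis Q_feller : forall (T : R) g, 0 < T -> rcontinuous rho g -> unit_fun g ->
  rcontinuous rho (fun y => expect (Q T y) g).

Variable z : X.
Hypothesis Q_ucec : forall e : R, 0 < e -> exists2 r : R, 0 < r &
  forall y, rball rho z r y -> \forall T \near +oo, tv_close e (Q T y) (Q T z).
Hypothesis Q_c2 : forall r : R, 0 < r -> exists2 c : R, 0 < c &
  forall x, frequently (fun T => c <= expect (Q T x) \1_(rball rho z r)).

Let unitQ (T : R) f : unit_fun f -> unit_fun (fun y => expect (Q T y) f).
Proof. by apply: unit_fun_expect => A mA; exact: measurable_Q. Qed.

Let unitQ_cst (T : R) y f : unit_fun f -> unit_fun (fun _ : X => expect (Q T y) f).
Proof. by move=> uf; apply: unit_fun_cst; rewrite expect_ge0//= expect_le1. Qed.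

Section MergingSequence.
Variables (T_ : nat -> R) (f_ : nat -> X -> R).
Hypothesis T_cvg : T_ n @[n --> \oo] --> +oo.
Hypothesis unit_f : forall n, unit_fun (f_ n).

Let gap n y := `|expect (Q (T_ n) y) (f_ n) - expect (Q (T_ n) z) (f_ n)|.

Let unit_gap n : unit_fun (gap n).
Proof. by apply: unit_fun_dist; [exact: unitQ | exact: unitQ_cst]. Qed.

Let gap_shift n x (t : R) : 0 < t -> 0 < T_ n -> gap n x <= t / T_ n + expect (Q t x) (gap n).
Proof.
move=> t0 T0; have := Q_shift x T0 t0 (unit_f n); rewrite Q_comm// => shift.
have := expect_dist (Q t x) (unitQ (T_ n) (unit_f n)) (unitQ_cst (T_ n) z (unit_f n)).
by rewrite expect_cst /gap; move: shift; rewrite !ler_norml; lra.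
Qed.

Let eventually_le (l : R) := forall y, \forall n \near \oo, gap n y <= l.

(* A single visit to a ball around [z] where the gap is eventually at most [e] improves any
   uniform bound on the limit superior of the gap. *)
Let contraction (e : R) : 0 < e -> exists2 a : R, 0 < a & forall l eta : R,
  e <= l <= 1 -> 0 < eta -> eventually_le l -> eventually_le (l - a * (l - e) + eta).
Proof.
move=> e0; have [r r0 gap_e] := Q_ucec e0; have [a a0 visit] := Q_c2 r0.
exists a => // l eta /andP[el l1] eta0 gap_l x.
have [t t1 a_le] := visit x 1; have t0 : 0 < t := lt_le_trans ltr01 t1.
set B := rball rho z r; have mB : measurable B := measurable_rball rho_metric borel z r.
pose b y : R := e * \1_B y + l * \1_(~` B) y.
have [uB uBC] := (unit_fun_indic (R := R) mB, unit_fun_indic (R := R) (measurableC mB)).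
have ub : unit_fun b.
  split; first by apply: measurable_funD; apply: measurable_funM => //; exact: measurable_unit_fun.
  by move=> y; rewrite /b !indicE in_setC; case: (_ \in _) => /=; lra.
have gap_b y : \forall n \near \oo, gap n y <= b y.
  have [By|nBy] := pselect (B y).
    have Tn_close : \forall n \near \oo, tv_close e (Q (T_ n) y) (Q (T_ n) z).
      exact: T_cvg (gap_e y By).
    apply: filterS Tn_close => n Tn_close.
    by rewrite /b !indicE in_setC mem_set//= mulr1 mulr0 addr0; exact: Tn_close.
  apply: filterS (gap_l y) => n gap_l_n.
  by rewrite /b !indicE in_setC memNset//= mulr0 mulr1 add0r.
have b_le : expect (Q t x) b <= l - a * (l - e).
  apply: (le_trans (le_expect_lin (Q t x) uB uBC ub (fun y => lexx _))).
  rewrite expect_indicC//.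
  have : a * (l - e) <= expect (Q t x) \1_B * (l - e) by rewrite ler_wpM2r// subr_ge0.
  by lra.
have eta20 : 0 < eta / 2 by rewrite divr_gt0.
near=> n; have Tn0 : 0 < T_ n by near: n; exact: T_cvg (nbhs_pinfty_gt (num_real _)).
have shift_small : t / T_ n <= eta / 2 by near: n; exact: T_cvg (near_div_le t eta20).
have : expect (Q t x) (gap n) <= expect (Q t x) b + eta / 2.
  by near: n; exact: expect_limsup_le.
by have := gap_shift x t0 Tn0; lra.
Unshelve. all: by end_near. Qed.

Lemma merging_sequence x (e : R) : 0 < e -> \forall n \near \oo,
  `|expect (Q (T_ n) x) (f_ n) - expect (Q (T_ n) z) (f_ n)| <= e.
Proof.
pose S : set R := [set l | 0 <= l <= 1 /\ eventually_le l].
have S1 : S 1.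
  split; first by rewrite ler01 lexx.
  by move=> y; apply: nearW => n; exact: unit_fun_le1.
have S_lbound : lbound S 0 by move=> l [/andP[]].
have S_inf : has_inf S by split; [exists 1 | exists 0].
suff infS_le0 : inf S <= 0.
  move=> e0; have [l [_ gap_l] l_lt] := inf_adherent e0 S_inf.
  by apply: filterS (gap_l x) => n /le_trans; apply; lra.
rewrite leNgt; apply/negP => infS_gt0.
have [|a a0 contract] := @contraction (inf S / 2); first by rewrite divr_gt0.
pose g := a * (inf S - inf S / 2).
have g0 : 0 < g by rewrite mulr_gt0//; lra.
have g40 : 0 < g / 4 by rewrite divr_gt0.
have [l [l01 gap_l] l_lt] := inf_adherent g40 S_inf.
have infS_l : inf S <= l by apply: ge_inf => //; exists 0.
have gap_l' : eventually_le (l - a * (l - inf S / 2) + g / 4) by apply: contract => //; lra.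
have g_le : g <= a * (l - inf S / 2) by rewrite ler_pM2l// lerD2r.
suff : S (l - a * (l - inf S / 2) + g / 4) by move=> /(ge_inf (ex_intro _ 0 S_lbound)); lra.
split => //; have [n gap_n] := filter_ex (gap_l' z).
by have := unit_fun_ge0 z (unit_gap n); lra.
Qed.

End MergingSequence.

Lemma merging x (e : R) : 0 < e -> \forall T \near +oo, tv_close e (Q T x) (Q T z).
Proof.
move=> e0; apply: contrapT => /not_near_frequently separated.
have witness (n : nat) : exists p : R * (X -> R), [/\ n%:R <= p.1, unit_fun p.2 &
    e < `|expect (Q p.1 x) p.2 - expect (Q p.1 z) p.2|].
  have [T nT far] := separated n%:R; apply: contrapT => nop; apply: far => f uf.
  by rewrite leNgt; apply/negP => lt; apply: nop; exists (T, f).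
have [p pP] := choice witness.
have [||n] := filter_ex (@merging_sequence (fun n => (p n).1) (fun n => (p n).2) _ _ x e e0).
- apply/cvgryPge => M; near=> n; apply: (@le_trans _ _ n%:R); last by case: (pP n).
  by near: n; exact: nbhs_infty_ger.
- by move=> n; case: (pP n).
- by have [_ _] := pP n; rewrite ltNge => /negP.
Unshelve. all: by end_near. Qed.

Let merged_after (e : R) (N : nat) : set X :=
  [set y | forall T : R, N%:R < T -> tv_close e (Q T y) (Q T z)].

Let closed_merged_after (e : R) N : ropen rho (~` merged_after e N).
Proof.
move=> y /existsNP[T /not_implyP[NT far]]; have T0 : 0 < T := le_lt_trans (ler0n _ N) NT.
have [g [cg ug lt]] : exists g, [/\ rcontinuous rho g, unit_fun g &
    e < `|expect (Q T y) g - expect (Q T z) g|].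
  apply: contrapT => nog; apply: far; apply: (tv_close_continuous rho_metric borel) => g cg ug.
  by rewrite leNgt; apply/negP => lt; apply: nog; exists g.
have [|r [r0 close]] := Q_feller T0 cg ug y (e := `|expect (Q T y) g - expect (Q T z) g| - e).
  by rewrite subr_gt0.
exists r; split => // w /close near_w merged_w; have := merged_w T NT g ug.
have := ler_distD (expect (Q T w) g) (expect (Q T y) g) (expect (Q T z) g).
by move: near_w; rewrite (distrC (expect (Q T w) g) (expect (Q T y) g)); lra.
Qed.

Let cover_merged_after (e : R) x : 0 < e -> exists N, merged_after e N x.
Proof.
move=> /(merging x)[M [_ merged]]; exists (Num.bound `|M|) => T MT; apply: merged.
by apply: lt_trans MT; exact: le_lt_trans (ler_norm M) (archi_boundP (normr_ge0 M)).
Qed.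

Let recurrent (A : set X) := exists2 c : R, 0 < c &
  frequently (fun T => c <= expect (Q T z) \1_A).

Let recurrentS A B : measurable A -> measurable B -> A `<=` B -> recurrent A -> recurrent B.
Proof.
move=> mA mB AB [c c0 freqA]; exists c => //; apply: sub_frequently freqA => T /le_trans; apply.
exact: le_expect_indic.
Qed.

(* Feller: a ball charged by [Q t z] is charged from all points near [z], and these recur. *)
Let recurrent_ball w (r t : R) : 0 < t -> 0 < expect (Q t z) \1_(rball rho w r) ->
  recurrent (rball rho w r).
Proof.
move=> t0 charged; have mB := measurable_rball rho_metric borel.
have uB x s : unit_fun (\1_(rball rho x s) : X -> R) by exact: unit_fun_indic.
have [g [cg ug g_le g_cvg]] :=
  ropen_approx_unit rho_metric borel (@ropen_rball _ _ _ rho_metric w r).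
have [n g_gt0] : exists n, 0 < expect (Q t z) (g n).
  have /cvgrPdist_lt/(_ _ charged)/filter_ex[n] := expect_cvg (m := Q t z) ug (uB w r) g_cvg.
  by rewrite ltr_distl => /andP[_ g_gt]; exists n; lra.
pose c := expect (Q t z) (g n) / 2; have c0 : 0 < c by rewrite divr_gt0.
have [s [s0 g_near]] := Q_feller t0 (cg n) (ug n) z c0.
have [a a0 visit] := Q_c2 s0.
have ca20 : 0 < c * a / 2 by rewrite divr_gt0// mulr_gt0.
exists (c * a / 2) => //.
have Tpos : \forall T \near +oo, 0 < T :> R by apply: nbhs_pinfty_gt; exact: num_real.
have := frequently_near (frequently_near (visit z) Tpos) (near_div_le t ca20).
apply: sub_frequently => T [[a_le T0] t_small].
have shift := Q_shift z T0 t0 (ug n).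
have g_ge : c * expect (Q T z) \1_(rball rho z s) <=
    expect (Q T z) (fun y => expect (Q t y) (g n)).
  rewrite -expectZ//; apply: le_expect => [||y].
  - by apply: unit_funZ => //; have := expect_le1 (Q t z) (ug n); rewrite /c; lra.
  - exact: unitQ.
  - rewrite indicE; case: (boolP (y \in _)) => [/set_mem/g_near|_].
      by rewrite mulr1 ltr_norml /c; lra.
    by rewrite mulr0 expect_ge0.
have g_le_ball : expect (Q T z) (g n) <= expect (Q T z) \1_(rball rho w r) by exact: le_expect.
have : c * a <= c * expect (Q T z) \1_(rball rho z s) by rewrite ler_pM2l.
by move: shift; rewrite ler_norml; lra.
Qed.

Let recurrent_points : set X := [set y | forall r : R, 0 < r -> recurrent (rball rho y r)].

Let recurrent_points_z : recurrent_points z.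
Proof. by move=> r /Q_c2[c c0 visit]; exists c. Qed.

Let measurable_recurrent_points : measurable recurrent_points.
Proof.
rewrite -(setCK recurrent_points); apply: measurableC; apply: (ropen_measurable borel).
move=> y /existsNP[r /not_implyP[r0 transient]]; exists r; split => // w yw rec_w.
have [s [s0 ws]] := ropen_rball rho_metric yw.
by apply: transient; apply: recurrentS ws (rec_w s s0); exact: measurable_rball.
Qed.

Let expect_recurrent_points (T : R) : 0 < T -> expect (Q T z) \1_recurrent_points = 1.
Proof.
move=> T0; have mY := measurable_recurrent_points.
suff null : (Q T z).-negligible (~` recurrent_points).
  have : expect (Q T z) \1_(~` recurrent_points) = 0.
    have mYC := measurableC mY; apply: EFin_inj; rewrite expect_indic//.
    exact/negligibleP.
  by rewrite expect_indicC//; lra.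
apply: (null_balls_negligible rho_polish borel) => y /existsNP[r /not_implyP[r0 transient]].
exists r => //; have mB := measurable_rball rho_metric borel y r.
apply: etrans (esym (expect_indic _ mB)) _; congr (_%:E); apply/eqP.
rewrite eq_le expect_ge0 ?andbT; last exact: unit_fun_indic.
by rewrite leNgt; apply/negP => /(recurrent_ball T0).
Qed.

(* Restarting from a recurrent ball on which all points merge with [z] uniformly in time, the
   averages at time [T] started from [z] are, up to [e], dominated by those at times [S >> T]. *)
Let domination (e : R) : 0 < e -> exists (gam : R) (P : R -> Prop), [/\ 0 < gam, frequently P &
  \forall T \near +oo, forall S f, 0 < S -> P S -> unit_fun f ->
    gam * (expect (Q T z) f - e) <= expect (Q S z) f + T / S].
Proof.
move=> e0; have [N [x [r [r0 Yx merged]]]] := baire_relative rho_polish recurrent_points_z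
  (@closed_merged_after e) (fun x => cover_merged_after x e0).
have [gam gam0 freqP] := Yx r r0.
exists gam, (fun S => gam <= expect (Q S z) \1_(rball rho x r)); split => //.
near=> T => S f S0 gam_le uf.
have NT : N%:R < T by near: T; apply: nbhs_pinfty_gt; exact: num_real.
have T0 : 0 < T := le_lt_trans (ler0n _ N) NT.
set C := rball rho x r `&` recurrent_points.
have mB : measurable (rball rho x r) := measurable_rball rho_metric borel x r.
have mC : measurable C by exact: measurableI.
have {}gam_le : gam <= expect (Q S z) \1_C.
  by rewrite expect_indicI_full// expect_recurrent_points.
have f_ge0 : 0 <= expect (Q S z) f by exact: expect_ge0.
have TS_ge0 : 0 <= T / S by rewrite divr_ge0 ?ltW.
have [le_e|gt_e] := leP (expect (Q T z) f) e.
  by apply: (@le_trans _ _ 0); [apply: mulr_ge0_le0; lra | lra].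
have f_le1 := expect_le1 (Q T z) uf.
have restart : (expect (Q T z) f - e) * expect (Q S z) \1_C <=
    expect (Q S z) (fun y => expect (Q T y) f).
  rewrite -expectZ; last exact: unit_fun_indic.
  apply: le_expect => [||y]; [|exact: unitQ|].
    by apply: unit_funZ; [lra | exact: unit_fun_indic].
  rewrite indicE; case: (boolP (y \in C)) => [/set_mem[By Yy]|_].
    by rewrite mulr1; have := merged y Yy By T NT f uf; rewrite ler_norml; lra.
  by rewrite mulr0 expect_ge0.
have : gam * (expect (Q T z) f - e) <= (expect (Q T z) f - e) * expect (Q S z) \1_C.
  by rewrite mulrC ler_wpM2l//; lra.
by have := Q_shift z S0 T0 uf; rewrite ler_norml; lra.
Unshelve. all: by end_near. Qed.

Section SigmaSmoothness.
Variable A : nat -> set X.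
Hypothesis mA : forall n, measurable (A n).
Hypothesis A_nonincreasing : forall n k, (n <= k)%N -> A k `<=` A n.
Hypothesis A_vanishes : forall x, \forall n \near \oo, ~ A n x.

Let q (T : R) n := expect (Q T z) \1_(A n).

Let escaping_mass (e gam : R) (P : R -> Prop) n : 0 < e -> 0 < gam ->
  (\forall T \near +oo, forall S f, 0 < S -> P S -> unit_fun f ->
    gam * (expect (Q T z) f - e) <= expect (Q S z) f + T / S) ->
  frequently (fun T => 2 * e < q T n) ->
  exists2 k, (n <= k)%N & \forall S \near +oo, P S -> gam * e / 2 <= q S n - q S k.
Proof.
move=> e0 gam0 dominates heavy.
have [T [heavyT dominatesT]] := frequently_ex (frequently_near heavy dominates).
have excess : 0 < q T n - 2 * e by rewrite subr_gt0.
have /cvgr0Pnorm_lt/(_ _ excess)[K _ light] := expect_indic_cvg0 (Q T z) mA A_vanishes.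
pose k := maxn K n; have nk : (n <= k)%N := leq_maxr _ _.
have {}light : q T k < q T n - 2 * e.
  by apply: le_lt_trans (ler_norm _) _; apply: light; exact: leq_maxl.
exists k => //; have mD : measurable (A n `\` A k) by exact: measurableD.
have qD S : q S n - q S k = expect (Q S z) \1_(A n `\` A k).
  by rewrite expect_indicD//; exact: A_nonincreasing.
have ge20 : 0 < gam * e / 2 by rewrite divr_gt0// mulr_gt0.
near=> S => PS; have S0 : 0 < S by near: S; exact: nbhs_pinfty_gt.
have TS_small : T / S <= gam * e / 2 by near: S; exact: near_div_le.
have := dominatesT S _ S0 PS (unit_fun_indic mD); rewrite -!qD.
have : gam * e <= gam * (q T n - q T k - e) by rewrite ler_pM2l//; lra.
by lra.
Unshelve. all: by end_near. Qed.

Lemma sigma_smooth (e : R) : 0 < e -> exists n, \forall T \near +oo, q T n <= 2 * e.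
Proof.
move=> e0; apply: contrapT => notsmooth.
have heavy n : frequently (fun T => 2 * e < q T n).
  have /not_near_frequently : ~ \forall T \near +oo, q T n <= 2 * e.
    by move=> smooth; apply: notsmooth; exists n.
  by apply: sub_frequently => T /negP; rewrite -ltNge.
have [gam [P [gam0 freqP dominates]]] := domination e0.
have mass_escapes (M : nat) : exists n, \forall S \near +oo, P S ->
    M%:R * (gam * e / 2) <= q S 0 - q S n.
  elim: M => [|M [n IH]].
    by exists 0%N; apply: nearW => S _; rewrite mul0r subrr.
  have [k nk escape] := escaping_mass e0 gam0 dominates (heavy n).
  exists k; near=> S => PS; rewrite -natr1 mulrDl mul1r.
  have : M%:R * (gam * e / 2) <= q S 0 - q S n by move: PS; near: S.
  have : gam * e / 2 <= q S n - q S k by move: PS; near: S.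
  by lra.
have c0 : 0 < gam * e / 2 by rewrite divr_gt0// mulr_gt0.
have [n heavyn] := mass_escapes (Num.bound (gam * e / 2)^-1).
have [S [PS /(_ PS)]] := frequently_ex (frequently_near freqP heavyn).
rewrite leNgt => /negP; apply; apply: (@le_lt_trans _ _ 1).
  have := expect_le1 (Q S z) (unit_fun_indic (mA 0)).
  by have := expect_ge0 (Q S z) (unit_fun_indic (mA n)); rewrite /q; lra.
by rewrite -ltr_pdivrMr// mul1r archi_boundP// invr_ge0 ltW.
Unshelve. all: by end_near. Qed.

End SigmaSmoothness.

Lemma averages_cauchy (e : R) : 0 < e ->
  \forall T \near +oo, \forall S \near +oo, tv_close e (Q T z) (Q S z).
Proof.
move=> e_gt0; pose e' := e / 4; have e0 : 0 < e' by rewrite divr_gt0.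
have eE : e = 4 * e' by rewrite mulrC divfK.
have mF N : measurable (~` merged_after e' N) by exact: (ropen_measurable borel).
have [||n light] := sigma_smooth mF _ _ e0.
- move=> m k mk x; apply: contra_not => merged T kT; apply: merged.
  by apply: le_lt_trans kT; rewrite ler_nat.
- move=> x; have [k merged] := cover_merged_after x e0; exists k => // m km; apply => T mT.
  by apply: merged; apply: le_lt_trans mT; rewrite ler_nat.
near=> T; have nT : n%:R < T by near: T; apply: nbhs_pinfty_gt; exact: num_real.
have T0 : 0 < T := le_lt_trans (ler0n _ n) nT.
near=> S => f uf; have S0 : 0 < S by near: S; exact: nbhs_pinfty_gt.
have TS_small : T / S <= e' by near: S; exact: near_div_le.
have unmerged : expect (Q S z) \1_(~` merged_after e' n) <= 2 * e' by near: S.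
have [uqT uqz] := (unitQ T uf, unitQ_cst T z uf).
have gap_le : expect (Q S z) (fun y => `|expect (Q T y) f - expect (Q T z) f|) <=
    e' * expect (Q S z) (fun=> 1) + 1 * expect (Q S z) \1_(~` merged_after e' n).
  apply: le_expect_lin => [|||y]; [exact: unit_fun1|exact: unit_fun_indic|exact: unit_fun_dist|].
  rewrite mulr1 mul1r indicE in_setC; case: (boolP (y \in _)) => /= [/set_mem merged|_].
    by rewrite addr0; exact: merged.
  by apply: le_trans (unit_fun_le1 y (unit_fun_dist uqT uqz)) _; rewrite lerDr ltW.
have := Q_shift z S0 T0 uf; have := expect_dist (Q S z) uqT uqz.
by move: gap_le; rewrite !expect_cst !ler_norml; lra.
Unshelve. all: by end_near. Qed.

Theorem exists_tv_limit : exists mu, tv_limit Q mu.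
Proof.
have [mu z_mu] := tv_complete averages_cauchy.
exists mu => x e e0; have e20 : 0 < e / 2 by rewrite divr_gt0.
near=> T; rewrite (splitr e); apply: (@tv_close_trans _ _ _ (Q T z)); near: T.
  exact: merging.
exact: z_mu.
Unshelve. all: by end_near. Qed.

End Averages.

(** * Mixtures and uniform laws *)

Section Mixture.
Context {R : realType} {d1 d2 : measure_display}.
Context {T1 : measurableType d1} {T2 : measurableType d2}.
Variables (m : probability T1 R) (K : T1 -> probability T2 R).
Hypothesis mK : forall A, measurable A -> measurable_fun setT (fun t => K t A).

Fact measurable_giry_kernel : measurable_fun setT (K : T1 -> giry T2 R).
Proof. exact: measurable_giry_codensity. Qed.

Definition mixture : set T2 -> \bar R := giry_bind (m : giry T1 R) measurable_giry_kernel.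

HB.instance Definition _ := Measure.on mixture.

Lemma ge0_integral_mixture (f : T2 -> \bar R) : measurable_fun setT f ->
  (forall x, 0 <= f x)%E -> (\int[mixture]_x f x = \int[m]_t \int[K t]_x f x)%E.
Proof. by move=> mf f0; exact: (giry_int_bind (m : giry T1 R) measurable_giry_kernel mf f0). Qed.

Lemma mixtureE A : measurable A -> mixture A = (\int[m]_t K t A)%E.
Proof.
move=> mA; transitivity (\int[mixture]_x (\1_A x)%:E)%E.
  by rewrite integral_indic// setIT.
rewrite ge0_integral_mixture.
- by apply: eq_integral => t _; rewrite integral_indic// setIT.
- exact/measurable_EFinP/measurable_indic.
- by move=> x; rewrite lee_fin indicE.
Qed.

Let mixture_setT : mixture setT = 1%E.
Proof.
rewrite mixtureE//; under eq_integral do rewrite probability_setT.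
by rewrite integral_cst//= mul1e probability_setT.
Qed.

HB.instance Definition _ := Measure_isProbability.Build _ _ _ mixture mixture_setT.

Lemma expect_mixture (f : T2 -> R) : unit_fun f ->
  expect mixture f = expect m (fun t => expect (K t) f).
Proof.
move=> uf; apply: EFin_inj; rewrite !EFin_expect//; last exact: unit_fun_expect.
rewrite ge0_integral_mixture => [||x]; last by rewrite lee_fin unit_fun_ge0.
  by apply: eq_integral => t _; rewrite EFin_expect.
exact/measurable_EFinP/measurable_unit_fun.
Qed.

End Mixture.

Lemma unit_fun_fubini (R : realType) d1 d2 (T1 : measurableType d1) (T2 : measurableType d2)
    (m : probability T2 R) (f : T1 * T2 -> R) :
  unit_fun f -> unit_fun (fun x => expect m (fun y => f (x, y))).
Proof.
move=> uf; have uf1 x : unit_fun (fun y => f (x, y)).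
  exact: unit_fun_comp (pair1_measurable x) uf.
split=> [|x]; last by rewrite expect_le1// expect_ge0.
apply: (measurableT_comp (fine_measurable measurableT)).
apply: (@measurable_fun_fubini_tonelli_F _ _ _ _ _ m (EFin \o f)).
  exact/measurable_EFinP/measurable_unit_fun.
by move=> p; rewrite lee_fin unit_fun_ge0.
Qed.

Lemma expect_fubini (R : realType) d1 d2 (T1 : measurableType d1) (T2 : measurableType d2)
    (m1 : probability T1 R) (m2 : probability T2 R) (f : T1 * T2 -> R) : unit_fun f ->
  expect m1 (fun x => expect m2 (fun y => f (x, y))) =
  expect m2 (fun y => expect m1 (fun x => f (x, y))).
Proof.
move=> uf; have uf_swap : unit_fun (fun p : T2 * T1 => f (p.2, p.1)) .
  by apply: unit_fun_comp uf; exact: measurable_swap.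
apply: EFin_inj; rewrite !EFin_expect; [|exact: (unit_fun_fubini _ uf_swap)|exact: unit_fun_fubini].
under eq_integral => x _.
  rewrite EFin_expect; last exact: unit_fun_comp (pair1_measurable x) uf.
  over.
under [RHS]eq_integral => y _.
  rewrite EFin_expect; last exact: unit_fun_comp (pair2_measurable y) uf.
  over.
apply: (fubini_tonelli (EFin \o f)); first exact/measurable_EFinP/measurable_unit_fun.
by move=> p; rewrite lee_fin unit_fun_ge0.
Qed.

Section Uniform.
Context {R : realType}.
Local Notation RR := (measurableTypeR R).

Definition uniform_law (T : R) : probability RR R :=
  if pselect (0 < T) is left T0 then uniform_prob T0 else dirac (0 : RR).

Lemma measurable_shift (u : R) : measurable_fun setT (fun s : RR => s + u : RR).
Proof. exact: measurable_funD. Qed.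

Lemma lebesgue_measure_shift (u : R) (A : set RR) : measurable A ->
  pushforward lebesgue_measure (fun s : RR => s + u : RR) A = lebesgue_measure A.
Proof.
have mshift := measurable_shift u.
move=> mA; apply/esym/lebesgue_measure_unique => //= _ [[a b]] _ <-.
rewrite /pushforward (_ : _ @^-1` _ = `]a - u, b - u]%classic).
  rewrite !lebesgue_measure_itv/= !lte_fin ltrD2r; case: ifPn => // _.
  by rewrite -!EFinB; congr (_%:E); lra.
by apply/seteqP; split => s /=; rewrite !in_itv/=; lra.
Qed.

Lemma ge0_integral_itv_shift (T u : R) (f : RR -> \bar R) : measurable_fun setT f ->
  (forall s, 0 <= f s)%E ->
  (\int[lebesgue_measure]_(s in `[0%R, T]) f (s + u)%R =
   \int[lebesgue_measure]_(s in `[u, (T + u)%R]) f s)%E.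
Proof.
move=> mf f0; pose shift (s : RR) : RR := s + u; have mshift := measurable_shift u.
have -> : `[0, T]%classic = shift @^-1` `[u, T + u]%classic.
  by apply/seteqP; split => s /=; rewrite /shift !in_itv/=; lra.
rewrite -(@ge0_integral_pushforward _ _ RR RR R shift mshift lebesgue_measure
  _ f)//; last exact: measurable_funS mf.
by apply: eq_measure_integral => A mA _; exact: lebesgue_measure_shift.
Qed.

Variable T : R.
Hypothesis T0 : 0 < T.
Implicit Types (f g : RR -> R) (e u : R).

Lemma ge0_integral_uniform_law (f : RR -> \bar R) :
  measurable_fun setT f -> (forall s, 0 <= f s)%E ->
  (\int[uniform_law T]_s f s = T^-1%:E * \int[lebesgue_measure]_(s in `[0%R, T]) f s)%E.
Proof.
move=> mf f0; rewrite /uniform_law; case: pselect => // T_gt0.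
by rewrite integral_uniform// subr0.
Qed.

Let EFin_expect_uniform f : unit_fun f -> (expect (uniform_law T) f)%:E =
  (T^-1%:E * \int[lebesgue_measure]_(s in `[0%R, T]) (f s)%:E)%E.
Proof.
move=> uf; rewrite EFin_expect// ge0_integral_uniform_law// => [|s].
  exact/measurable_EFinP/measurable_unit_fun.
by rewrite lee_fin unit_fun_ge0.
Qed.

Lemma expect_uniform_le f e : unit_fun f -> (forall s, 0 <= s <= T -> f s <= e) ->
  expect (uniform_law T) f <= e.
Proof.
move=> uf fe; rewrite -lee_fin EFin_expect_uniform// lee_pdivrMl// -EFinM.
have <- : (\int[lebesgue_measure]_(s in `[0%R, T]) e%:E = (T * e)%:E :> \bar R)%E.
  by rewrite integral_cst//= lebesgue_measure_itv/= lte_fin T0 oppr0 adde0 -EFinM mulrC.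
apply: ge0_le_integral => //= [s _|].
- by rewrite lee_fin unit_fun_ge0.
- by apply: measurable_funTS; exact/measurable_EFinP/measurable_unit_fun.
Qed.

Lemma expect_uniform_close f g e : unit_fun f -> unit_fun g ->
  (forall s, 0 <= s <= T -> `|f s - g s| <= e) ->
  `|expect (uniform_law T) f - expect (uniform_law T) g| <= e.
Proof.
move=> uf ug fg; apply: le_trans (expect_dist _ uf ug) _.
by apply: expect_uniform_le => //; exact: unit_fun_dist.
Qed.

Lemma eq_expect_uniform f g : unit_fun f -> unit_fun g ->
  (forall s, 0 <= s <= T -> f s = g s) -> expect (uniform_law T) f = expect (uniform_law T) g.
Proof.
move=> uf ug fg; apply/eqP; rewrite -subr_eq0 -normr_le0.
by apply: expect_uniform_close => // s /fg ->; rewrite subrr normr0.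
Qed.

Let expect_uniform_shift_le f u : 0 <= u -> unit_fun f ->
  expect (uniform_law T) (fun s => f (s + u)) <= expect (uniform_law T) f + u / T.
Proof.
move=> u0 uf; have ufu := unit_fun_comp (measurable_shift u) uf.
have mf : measurable_fun setT (EFin \o f) by exact/measurable_EFinP/measurable_unit_fun.
have mfD (D : set RR) : measurable_fun D (EFin \o f) by exact: measurable_funTS.
have f0 s : (0 <= (f s)%:E)%E by rewrite lee_fin unit_fun_ge0.
rewrite -lee_fin EFinD !EFin_expect_uniform// mulrC EFinM -muleDr//; last first.
  by rewrite ge0_adde_def// inE ?integral_ge0// lee_fin.
apply: lee_wpmul2l; first by rewrite lee_fin invr_ge0 ltW.
rewrite (ge0_integral_itv_shift T u mf)//.
apply: (@le_trans _ _ (\int[lebesgue_measure]_(s in `[0%R, T] `|` `]T, (T + u)%R]) (f s)%:E)%E).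
  apply: ge0_subset_integral => //; [exact: measurableU | by move=> s _; exact: f0 |].
  by move=> s /=; rewrite !in_itv/=; case: (leP s T) => sT; [left|right]; lra.
rewrite ge0_integral_setU//=; last by apply/disj_setPS => s [] /=; rewrite !in_itv/=; lra.
rewrite leeD2l//; apply: (@le_trans _ _ (\int[lebesgue_measure]_(s in `]T, (T + u)%R]) 1)%E).
  by apply: ge0_le_integral => // s _; rewrite lee_fin unit_fun_le1.
rewrite integral_cst//= mul1e lebesgue_measure_itv/= lte_fin.
by case: ifPn => _; rewrite ?lee_fin//; lra.
Qed.

Lemma expect_uniform_shift f u : 0 <= u -> unit_fun f ->
  `|expect (uniform_law T) (fun s => f (s + u)) - expect (uniform_law T) f| <= u / T.
Proof.
move=> u0 uf; have ufu := unit_fun_comp (measurable_shift u) uf.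
have := expect_uniform_shift_le u0 uf; have := expect_uniform_shift_le u0 (unit_fun1B uf).
by rewrite !expect1B// ler_norml; lra.
Qed.

End Uniform.

(** * Couplings and weighted distances *)

Section ErealLimits.
Context {R : realType} {I : Type} (F : set_system I) {FF : ProperFilter F}.
Implicit Type u : I -> \bar R.

Lemma cvge0_le u : (forall i, 0 <= u i)%E ->
  (forall e : R, 0 < e -> \forall i \near F, (u i <= e%:E)%E) -> u i @[i --> F] --> 0%E.
Proof.
move=> u0 u_le; have fin i (e : R) : (u i <= e%:E)%E -> u i \is a fin_num.
  by move=> ue; rewrite ge0_fin_numE// (le_lt_trans ue)// ltry.
apply/fine_cvgP; split; first by apply: filterS (u_le 1 ltr01) => i; exact: fin.
apply/cvgrPdist_le => e /u_le; apply: filterS => i ue /=.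
by rewrite sub0r normrN ger0_norm ?fine_ge0// -lee_fin fineK//; exact: fin ue.
Qed.

Lemma cvge0_near_le u (e : R) : 0 < e -> u i @[i --> F] --> 0%E ->
  \forall i \near F, (u i <= e%:E)%E.
Proof.
move=> e0 u_cvg0; have : nbhs (0%E : \bar R) [set y | (y < e%:E)%E].
  by apply: open_ereal_lt'; rewrite lte_fin.
move=> /u_cvg0 u_lt; have {}u_lt : \forall i \near F, (u i < e%:E)%E by exact: u_lt.
by apply: filterS u_lt => i /ltW.
Qed.

End ErealLimits.

Lemma ge0_integrable_lty (R : realType) d (X : measurableType d) (m : {measure set X -> \bar R})
    (D : set X) (h : X -> R) : measurable D -> measurable_fun D h -> (forall x, D x -> 0 <= h x) ->
  (\int[m]_(x in D) (h x)%:E < +oo)%E -> m.-integrable D (EFin \o h).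
Proof.
move=> mD mh h0 h_lty; apply/integrableP; split; first exact/measurable_EFinP.
rewrite (eq_integral (fun x => (h x)%:E))// => x /set_mem Dx /=.
by rewrite ger0_norm// h0.
Qed.

Lemma dominated_integrable_lty (R : realType) d (X : measurableType d)
    (m : {measure set X -> \bar R}) (w f : X -> R) :
  measurable_fun setT w -> (\int[m]_x (w x)%:E < +oo)%E ->
  measurable_fun setT f -> (forall x, `|f x| <= w x) -> m.-integrable setT (EFin \o f).
Proof.
move=> mw w_lty mf fw.
apply: (@le_integrable _ _ _ m setT measurableT _ (EFin \o w)).
- exact/measurable_EFinP.
- by move=> x _ /=; rewrite lee_fin (le_trans (fw x))// ler_norm.
- by apply: ge0_integrable_lty => // x _; exact: le_trans (fw x).
Qed.

Section Tail.
Context {R : realType} {d : measure_display} {X : measurableType d}.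
Implicit Types (W h : X -> R) (K : R).

Definition tail W K (x : X) : R := if K <= W x then W x else 0.

Lemma measurable_tail W K : measurable_fun setT W -> measurable_fun setT (tail W K).
Proof.
move=> mW; apply: measurable_fun_if => //; last exact: measurable_funS mW.
exact: measurable_fun_ler.
Qed.

Lemma tail_ge0 W K x : 0 <= W x -> 0 <= tail W K x.
Proof. by rewrite /tail; case: ifP. Qed.

Lemma le_tail W K x : 0 <= K -> W x <= K + tail W K x.
Proof. by move=> K0; rewrite /tail; case: (leP K (W x)) => WK; lra. Qed.

Definition uniformly_integrable {I : Type} W (p : I -> probability X R) : Prop :=
  forall e : R, 0 < e -> exists2 K : R, 0 < K &
    forall i, (\int[p i]_x (tail W K x)%:E <= e%:E)%E.

Lemma uniformly_integrable_lty {I : Type} W (p : I -> probability X R) i :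
  measurable_fun setT W -> (forall x, 0 <= W x) -> uniformly_integrable W p ->
  (\int[p i]_x (W x)%:E < +oo)%E.
Proof.
move=> mW W0 /(_ 1 ltr01)[K K0 tail1]; have mT := measurable_tail K mW.
apply: (@le_lt_trans _ _ (\int[p i]_x (K%:E + (tail W K x)%:E))%E).
  apply: ge0_le_integral => //.
  - by move=> x _; rewrite lee_fin.
  - exact/measurable_EFinP.
  - by apply: emeasurable_funD => //; exact/measurable_EFinP.
  - by move=> x _; rewrite -EFinD lee_fin le_tail// ltW.
rewrite ge0_integralD//; last 3 first.
- by move=> x _; rewrite lee_fin ltW.
- by move=> x _; rewrite lee_fin tail_ge0.
- exact/measurable_EFinP.
rewrite integral_cst//= probability_setT mule1.
by apply: le_lt_trans (leeD (lexx _) (tail1 i)) _; rewrite -EFinD ltry.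
Qed.

End Tail.

Lemma uniformly_integrable_mixture (R : realType) d1 d2 (T1 : measurableType d1)
    (T2 : measurableType d2) (J : Type) (m : J -> probability T1 R) (K : T1 -> probability T2 R)
    (mK : forall A, measurable A -> measurable_fun setT (fun t => K t A)) (W : T2 -> R) :
  measurable_fun setT W -> (forall x, 0 <= W x) ->
  uniformly_integrable W K -> uniformly_integrable W (fun j => mixture (m j) mK).
Proof.
move=> mW W0 uiK e /uiK[M M0 tailK]; exists M => // j.
have mT : measurable_fun setT (fun x => (tail W M x)%:E).
  exact/measurable_EFinP/measurable_tail.
have T0 x : (0 <= (tail W M x)%:E)%E by rewrite lee_fin tail_ge0.
rewrite ge0_integral_mixture//; apply: (@le_trans _ _ (\int[m j]_t e%:E)%E).
  apply: ge0_le_integral => //; first by move=> t _; exact: integral_ge0.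
  exact: measurable_fun_integral_kernel.
by rewrite integral_cst//= probability_setT mule1.
Qed.

Section TotalVariationLimit.
Context {R : realType} {d : measure_display} {X : measurableType d}.
Implicit Types (m mu : probability X R) (h : X -> R).

Lemma tv_close_bounded (e M : R) m1 m2 h : 0 < M -> measurable_fun setT h ->
  (forall x, 0 <= h x <= M) -> tv_close e m1 m2 -> `|expect m1 h - expect m2 h| <= M * e.
Proof.
move=> M0 mh h0M close; have uh : unit_fun (fun x => M^-1 * h x).
  split=> [|x]; first exact: measurable_funM.
  have /andP[h0 hM] := h0M x; apply/andP; split; last by rewrite ler_pdivrMl// mulr1.
  by rewrite mulr_ge0// invr_ge0 ltW.
have hE m : expect m h = M * expect m (fun x => M^-1 * h x).
  by rewrite -expectZ//; apply: eq_Rintegral => x _; rewrite mulVKf// gt_eqF.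
by rewrite !hE -mulrBr normrM (gtr0_norm M0) ler_pM2l//; exact: close.
Qed.

Lemma tv_limit_integral_le (I : Type) (p : I -> probability X R) mu h (c : R) :
  (forall e : R, 0 < e -> exists i, tv_close e (p i) mu) ->
  measurable_fun setT h -> (forall x, 0 <= h x) ->
  (forall i, \int[p i]_x (h x)%:E <= c%:E)%E -> (\int[mu]_x (h x)%:E <= c%:E)%E.
Proof.
move=> p_mu mh h0 h_le; pose g (n : nat) x := Num.min (h x) n.+1%:R.
have mg n : measurable_fun setT (g n) by exact: measurable_minr.
have g0n n x : 0 <= g n x <= n.+1%:R by rewrite le_min h0 ler0n ge_min lexx orbT.
have gE m n : (expect m (g n))%:E = (\int[m]_x (g n x)%:E)%E.
  rewrite fineK//; apply: integrable_fin_num => //.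
  apply: (@integrable_bounded _ _ _ m (g n) n.+1%:R) => // x.
  by have /andP[g0 gn] := g0n n x; rewrite ger0_norm.
have g_le n : (\int[mu]_x (g n x)%:E <= c%:E)%E.
  rewrite -gE lee_fin; apply/ler_addgt0Pr => e e0.
  have [|i close] := p_mu (n.+1%:R^-1 * e); first by rewrite mulr_gt0// invr_gt0.
  have := tv_close_bounded (ltr0Sn _ n) (mg n) (g0n n) close; rewrite mulVKf//.
  have : expect (p i) (g n) <= c.
    rewrite -lee_fin gE; apply: le_trans (h_le i); apply: ge0_le_integral => //.
    + by move=> x _; rewrite lee_fin; case/andP: (g0n n x).
    + exact/measurable_EFinP.
    + exact/measurable_EFinP.
    + by move=> x _; rewrite lee_fin ge_min lexx.
  by rewrite ler_norml; lra.
have g_cvg : (\int[mu]_x (g n x)%:E)%E @[n --> \oo] --> (\int[mu]_x (h x)%:E)%E.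
  have -> : (\int[mu]_x (h x)%:E = \int[mu]_x limn (fun n => (g n x)%:E))%E.
    apply: eq_integral => x _; apply/esym/cvg_lim => //; apply: cvg_near_cst.
    near=> n; congr (_%:E); apply/min_idPl; apply: (@le_trans _ _ n%:R); last by rewrite ler_nat.
    by near: n; exact: nbhs_infty_ger.
  apply: cvg_monotone_convergence => //.
  - by move=> n; exact/measurable_EFinP.
  - by move=> n x _; rewrite lee_fin; case/andP: (g0n n x).
  - move=> x _ n k nk; rewrite lee_fin le_min !ge_min lexx /=.
    by rewrite ler_nat ltnS nk orbT.
rewrite -(cvg_lim _ g_cvg)//; apply: lime_le; first by apply/cvg_ex; eexists; exact: g_cvg.
exact: nearW.
Unshelve. all: by end_near. Qed.

End TotalVariationLimit.

Lemma ge0_integral_prodD (R : realType) d (X : measurableType d)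
    (n1 n2 : {finite_measure set X -> \bar R}) (w : X -> R) :
  measurable_fun setT w -> (forall x, 0 <= w x) ->
  (\int[n1 \x n2]_p (w p.1 + w p.2)%:E =
   \int[n1]_x (w x)%:E * n2 setT + \int[n2]_x (w x)%:E * n1 setT)%E.
Proof.
move=> mw w0; have mwE : measurable_fun setT (fun x => (w x)%:E) by exact/measurable_EFinP.
rewrite (fubini_tonelli1 (fun p : X * X => (w p.1 + w p.2)%:E)) => [||p]; last 2 first.
- by apply/measurable_EFinP; apply: measurable_funD; apply: measurableT_comp.
- by rewrite lee_fin addr_ge0.
rewrite /fubini_F /= (eq_integral (fun x => (w x)%:E * n2 setT + \int[n2]_y (w y)%:E)%E).
  rewrite ge0_integralD//; last 3 first.
  - by move=> x _; rewrite mule_ge0// lee_fin.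
  - by apply: emeasurable_funM.
  - by move=> x _; apply: integral_ge0 => y _; rewrite lee_fin.
  rewrite ge0_integralZr//; last by move=> x _; rewrite lee_fin.
  by rewrite integral_cst.
move=> x _; under eq_integral do rewrite EFinD.
by rewrite ge0_integralD//; [rewrite integral_cst | move=> *; rewrite lee_fin..].
Qed.

Section Coupling.
Context {R : realType} {d : measure_display} {X : measurableType d}.
Implicit Types (m : probability X R) (A : set X) (f w h : X -> R).

Definition is_coupling (pi : probability (X * X)%type R) (m1 m2 : probability X R) : Prop :=
  forall A, measurable A -> pi (A `*` setT) = m1 A /\ pi (setT `*` A) = m2 A.

Definition weighted_dist w (m1 m2 : probability X R) : \bar R :=
  ereal_inf [set (\int[pi]_(p in [set p : X * X | p.1 <> p.2]) (w p.1 + w p.2)%:E)%E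
            | pi in [set pi | is_coupling pi m1 m2]].

Lemma weighted_dist_ge0 w m1 m2 : (forall x, 0 <= w x) -> (0 <= weighted_dist w m1 m2)%E.
Proof.
move=> w0; apply: le_ereal_inf_tmp => _ [pi _ <-]; apply: integral_ge0 => p _.
by rewrite lee_fin addr_ge0.
Qed.

Lemma expect_marginal d' (Y : measurableType d') (pi : probability Y R) m (pr : Y -> X) w f :
  measurable_fun setT pr -> (forall A, measurable A -> pi (pr @^-1` A) = m A) ->
  measurable_fun setT w -> (\int[m]_x (w x)%:E < +oo)%E ->
  measurable_fun setT f -> (forall x, `|f x| <= w x) ->
  pi.-integrable setT (EFin \o (f \o pr)) /\ expect m f = expect pi (f \o pr).
Proof.
move=> mpr piE mw w_lty mf fw.
have w0 x : 0 <= w x by exact: le_trans (fw x).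
have eq_push A : measurable A -> A `<=` setT -> m A = pushforward pi pr A.
  by move=> mA _; rewrite -piE.
have int_pi : pi.-integrable setT (EFin \o (f \o pr)).
  apply: (@dominated_integrable_lty _ _ _ _ (w \o pr)) => //.
  - exact: measurableT_comp mw mpr.
  - move: w_lty; rewrite (eq_measure_integral (pushforward pi pr) eq_push).
    rewrite (ge0_integral_pushforward mpr)//; first exact/measurable_EFinP.
    by move=> x _; rewrite lee_fin.
  - exact: measurableT_comp mf mpr.
  - by move=> y; exact: fw.
split => //; congr fine; rewrite (eq_measure_integral (pushforward pi pr) eq_push).
by rewrite (integral_pushforward mpr)//; exact/measurable_EFinP.
Qed.

Hypothesis measurable_offdiag : measurable [set p : X * X | p.1 <> p.2].

Lemma expect_dist_coupling (pi : probability (X * X)%type R) m1 m2 w f : is_coupling pi m1 m2 ->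
  measurable_fun setT w ->
  (\int[m1]_x (w x)%:E < +oo)%E -> (\int[m2]_x (w x)%:E < +oo)%E ->
  measurable_fun setT f -> (forall x, `|f x| <= w x) ->
  (`|expect m1 f - expect m2 f|%:E <=
   \int[pi]_(p in [set p : X * X | p.1 <> p.2]) (w p.1 + w p.2)%:E)%E.
Proof.
move=> pi_m mw w1 w2 mf fw.
have pi1 A : measurable A -> pi (fst @^-1` A) = m1 A.
  by move=> /pi_m[<- _]; congr (pi _); apply/seteqP; split => -[x y] //= [].
have pi2 A : measurable A -> pi (snd @^-1` A) = m2 A.
  by move=> /pi_m[_ <-]; congr (pi _); apply/seteqP; split => -[x y] //= [].
have [int1 ->] := expect_marginal measurable_fst pi1 mw w1 mf fw.
have [int2 ->] := expect_marginal measurable_snd pi2 mw w2 mf fw.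
have mf12 : measurable_fun setT (fun p : X * X => (f p.1 - f p.2)%:E).
  by apply/measurable_EFinP; apply: measurable_funB; apply: measurableT_comp.
rewrite -RintegralB// (EFin_normr_Rintegral measurableT (integrableB measurableT int1 int2)).
apply: (le_trans (le_abse_integral _ measurableT mf12)).
rewrite [leRHS]integral_mkcond; apply: ge0_le_integral => //.
- exact: measurableT_comp.
- apply/(measurable_restrictT _ measurable_offdiag); apply: measurable_funTS.
  by apply/measurable_EFinP; apply: measurable_funD; apply: measurableT_comp.
- move=> [x y] _; rewrite patchE; case: ifPn => [_|].
    by rewrite /= lee_fin; have := fw x; have := fw y; rewrite !ler_norml; lra.
  by rewrite notin_setE /= => /contrapT ->; rewrite subrr normr0.
Qed.

Lemma expect_dist_le_weighted m1 m2 w f : measurable_fun setT w ->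
  (\int[m1]_x (w x)%:E < +oo)%E -> (\int[m2]_x (w x)%:E < +oo)%E ->
  measurable_fun setT f -> (forall x, `|f x| <= w x) ->
  (`|expect m1 f - expect m2 f|%:E <= weighted_dist w m1 m2)%E.
Proof.
by move=> mw w1 w2 mf fw; apply: le_ereal_inf_tmp => _ [pi pi_m <-]; exact: expect_dist_coupling.
Qed.

Section CommonPartCoupling.
Variables (m1 m2 : probability X R) (m : {measure set X -> \bar R}).
Variables n1 n2 : {finite_measure set X -> \bar R}.
Hypothesis m1E : forall A, measurable A -> m1 A = (m A + n1 A)%E.
Hypothesis m2E : forall A, measurable A -> m2 A = (m A + n2 A)%E.
Hypothesis n12T : n2 setT = n1 setT.

Let c := fine (n1 setT).

Let n1T : n1 setT = c%:E. Proof. by rewrite /c fineK// fin_num_measure. Qed.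

Let n2T : n2 setT = c%:E. Proof. by rewrite n12T n1T. Qed.

Let c_ge0 : 0 <= c^-1. Proof. by rewrite invr_ge0 fine_ge0. Qed.

Let rescale (a : \bar R) : (c = 0 -> a = 0%E) -> (c^-1%:E * (a * c%:E) = a)%E.
Proof.
move=> a0; have [c0|c_neq0] := eqVneq c 0; first by rewrite (a0 c0) mul0e mule0.
by rewrite muleC -muleA -EFinM divff// mule1.
Qed.

Let excess0 (n : {finite_measure set X -> \bar R}) A : n setT = c%:E -> measurable A ->
  c = 0 -> n A = 0%E.
Proof.
move=> nT mA c0; apply/eqP.
by rewrite -measure_le0 -[0%E]/(0%:E) -c0 -nT le_measure// inE.
Qed.

Let diag (x : X) : X * X := (x, x).

Let prodE A B : measurable A -> measurable B -> ((n1 \x n2) (A `*` B) = n1 A * n2 B)%E.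
Proof. exact: product_measure1E. Qed.

Let glued_probability : exists pi : probability (X * X)%type R,
  (forall E : set (X * X), pi E = (m (diag @^-1` E) + c^-1%:E * (n1 \x n2) E)%E) /\
  (forall D F, measurable D -> measurable_fun setT F -> (forall p, 0 <= F p)%E ->
    \int[pi]_(p in D) F p =
    \int[m]_(x in diag @^-1` D) F (x, x) + c^-1%:E * \int[n1 \x n2]_(p in D) F p)%E.
Proof.
have mdiag : measurable_fun setT diag by exact: measurable_fun_pair.
pose push : {measure set (X * X) -> \bar R} := pushforward m diag.
pose on_diag : {measure set (X * X) -> \bar R} := push mdiag.
pose off_diag : {measure set (X * X) -> \bar R} := mscale (NngNum c_ge0) (n1 \x n2)%E.
pose glued : {measure set (X * X) -> \bar R} := measure_add on_diag off_diag.
have gluedE E : glued E = (m (diag @^-1` E) + c^-1%:E * (n1 \x n2) E)%E by exact: measure_addE.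
have gluedT : glued setT = 1%E.
  rewrite gluedE -setXTT prodE// n2T rescale; last exact: excess0.
  by rewrite setXTT preimage_setT -m1E// probability_setT.
pose pi : probability (X * X)%type R := HB.pack (glued : set (X * X) -> \bar R) glued
  (Measure_isProbability.Build _ _ _ glued gluedT).
exists pi; split=> [E|D F mD mF F0]; first exact: gluedE.
have mFD : measurable_fun D F by exact: measurable_funTS.
transitivity (\int[measure_add on_diag off_diag]_(p in D) F p)%E; first exact: eq_measure_integral.
rewrite ge0_integral_measure_add// ge0_integral_mscale//; congr (_ + _)%E.
exact: ge0_integral_pushforward.
Qed.

Lemma common_part_coupling : exists pi : probability (X * X)%type R, is_coupling pi m1 m2 /\
  forall w, measurable_fun setT w -> (forall x, 0 <= w x) ->
    (\int[pi]_(p in [set p : X * X | p.1 <> p.2]) (w p.1 + w p.2)%:E <=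
     \int[n1]_x (w x)%:E + \int[n2]_x (w x)%:E)%E.
Proof.
have [pi [piE pi_int]] := glued_probability.
exists pi; split=> [A mA|w mw w0].
  rewrite !piE !prodE// m1E// m2E//; split.
    by rewrite n2T rescale; [congr (m _ + _)%E; apply/seteqP; split => x //= [] | exact: excess0].
  rewrite n1T [X in (c^-1%:E * X)%E]muleC rescale; last exact: excess0.
  by congr (m _ + _)%E; apply/seteqP; split => x //= [].
have mF : measurable_fun setT (fun p : X * X => (w p.1 + w p.2)%:E).
  by apply/measurable_EFinP; apply: measurable_funD; apply: measurableT_comp.
have F0 (p : X * X) : (0 <= (w p.1 + w p.2)%:E)%E by rewrite lee_fin addr_ge0.
have int_ge0 (n : {finite_measure set X -> \bar R}) : (0 <= \int[n]_x (w x)%:E)%E.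
  by apply: integral_ge0 => x _; rewrite lee_fin.
rewrite (pi_int _ _ measurable_offdiag mF F0) (_ : diag @^-1` _ = set0); last first.
  by apply/seteqP; split => x.
rewrite integral_set0 add0e.
apply: (@le_trans _ _ (c^-1%:E * \int[n1 \x n2]_p (w p.1 + w p.2)%:E)%E).
  by apply: lee_wpmul2l => //; apply: ge0_subset_integral.
rewrite ge0_integral_prodD// n1T n2T -ge0_muleDl//.
have [c0|c_neq0] := eqVneq c 0; first by rewrite c0 mule0 mule0 adde_ge0.
by rewrite rescale// => c0; rewrite c0 eqxx in c_neq0.
Qed.

End CommonPartCoupling.

Lemma excess_integral_le (m' : probability X R) (m : {measure set X -> \bar R})
    (n : {finite_measure set X -> \bar R}) (K : R) w h :
  (forall A, measurable A -> m' A = (m A + n A)%E) -> 0 <= K ->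
  measurable_fun setT w -> measurable_fun setT h -> (forall x, 0 <= w x) -> (forall x, 0 <= h x) ->
  (forall x, w x <= K + h x) ->
  (\int[n]_x (w x)%:E <= K%:E * n setT + \int[m']_x (h x)%:E)%E.
Proof.
move=> m'E K0 mw mh w0 h0 wKh.
have mhE : measurable_fun setT (fun x => (h x)%:E) by exact/measurable_EFinP.
rewrite (@eq_measure_integral _ _ _ _ (measure_add m n) m') => [|A mA _]; last first.
  by rewrite [RHS]measure_addE -m'E.
rewrite ge0_integral_measure_add//; last by move=> x _; rewrite lee_fin.
apply: (@le_trans _ _ (\int[n]_x (K%:E + (h x)%:E))%E).
  apply: ge0_le_integral => //.
  - by move=> x _; rewrite lee_fin.
  - exact/measurable_EFinP.
  - exact: emeasurable_funD.
  - by move=> x _; rewrite -EFinD lee_fin.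
rewrite ge0_integralD//; last by move=> x _; rewrite lee_fin.
rewrite integral_cst//; apply: leeD => //.
by rewrite leeDr// integral_ge0// => x _; rewrite lee_fin.
Qed.

Lemma weighted_dist_le (m1 m2 : probability X R) (K e : R) w h : tv_close e m1 m2 -> 0 <= K ->
  measurable_fun setT w -> measurable_fun setT h -> (forall x, 0 <= w x) -> (forall x, 0 <= h x) ->
  (forall x, w x <= K + h x) ->
  (weighted_dist w m1 m2 <=
   (2 * K * e)%:E + \int[m1]_x (h x)%:E + \int[m2]_x (h x)%:E)%E.
Proof.
move=> close K0 mw mh w0 h0 wKh.
have [P [m [n1 [n2 [mP m1E m2E [n1T n2T]]]]]] := common_part m1 m2.
have [pi [pi_m pi_le]] := common_part_coupling m1E m2E n2T.
apply: (@le_trans _ _ (\int[n1]_x (w x)%:E + \int[n2]_x (w x)%:E)%E).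
  by apply: ge_ereal_inf; eexists; [exists pi; [exact: pi_m|] | exact: pi_le].
have n1_le := excess_integral_le m1E K0 mw mh w0 h0 wKh.
have n2_le := excess_integral_le m2E K0 mw mh w0 h0 wKh.
apply: le_trans (leeD n1_le n2_le) _.
rewrite addeACA -[leRHS]addeA; apply: leeD => //.
rewrite n2T n1T -!expect_indic// -EFinB -EFinM -EFinD lee_fin.
have /(le_trans (ler_norm _)) := close _ (unit_fun_indic mP) => /(ler_wpM2l K0).
by lra.
Qed.

Lemma weighted_dist_cvg0 {I : Type} (F : set_system I) {FF : ProperFilter F}
    (p : I -> probability X R) (mu : probability X R) w W :
  measurable_fun setT w -> measurable_fun setT W -> (forall x, 0 <= w x <= W x) ->
  uniformly_integrable W p -> (forall e : R, 0 < e -> \forall i \near F, tv_close e (p i) mu) ->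
  weighted_dist w (p i) mu @[i --> F] --> 0%E.
Proof.
move=> mw mW wW uiW p_mu.
have w0 x : 0 <= w x by case/andP: (wW x).
have W0 x : 0 <= W x by case/andP: (wW x) => _; exact: le_trans.
apply: cvge0_le => [i|e e0]; first exact: weighted_dist_ge0.
have e40 : 0 < e / 4 by rewrite divr_gt0.
have [K K0 tail_le] := uiW _ e40.
have mT := measurable_tail K mW; have T0 x := tail_ge0 K (W0 x).
have tail_mu : (\int[mu]_x (tail W K x)%:E <= (e / 4)%:E)%E.
  by apply: (tv_limit_integral_le (p := p)) => // r /p_mu/filter_ex.
have eK0 : 0 < e / (4 * K) by rewrite divr_gt0// mulr_gt0.
apply: filterS (p_mu _ eK0) => i close.
apply: le_trans (weighted_dist_le close (ltW K0) mw mT w0 T0 _) _ => [x|].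
  by case/andP: (wW x) => _ /le_trans; apply; rewrite le_tail// ltW.
apply: (@le_trans _ _ ((e / 2)%:E + (e / 4)%:E + (e / 4)%:E)%E).
  apply: leeD => //; apply: leeD => //; rewrite lee_fin le_eqVlt; apply/orP; left; apply/eqP.
  by field; exact: lt0r_neq0.
by rewrite -!EFinD lee_fin; lra.
Qed.

End Coupling.

(** * Limits superior at infinity *)

Section LimsupInfty.
Context {R : realType}.
Implicit Types (g : R -> \bar R) (c : R).

Lemma limsup_infty_eq0 g : (forall t, 0 <= g t)%E ->
  (forall e : R, 0 < e -> \forall t \near +oo, (g t <= e%:E)%E) -> limsup_infty g = 0%E.
Proof.
move=> g0 g_le; apply/eqP; rewrite eq_le; apply/andP; split.
  apply/lee_addgt0Pr => e /g_le[M [_ g_leM]]; rewrite add0e.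
  apply: ge_ereal_inf; exists (ereal_sup (g @` [set t | M + 1 <= t])); first by exists (M + 1).
  by apply: ge_ereal_sup => _ [t /= Mt <-]; apply: g_leM; apply: lt_le_trans Mt; rewrite ltrDl.
apply: le_ereal_inf_tmp => _ [T _ <-].
by apply: le_ereal_sup_tmp; exists (g T) => //; exists T => //=.
Qed.

Lemma le_limsup_infty g c : frequently (fun t => c%:E <= g t)%E -> (c%:E <= limsup_infty g)%E.
Proof.
move=> freq; apply: le_ereal_inf_tmp => _ [T _ <-]; have [t Tt ct] := freq T.
by apply: le_ereal_sup_tmp; exists (g t) => //; exists t.
Qed.

Lemma lt_limsup_infty g c : (c%:E < limsup_infty g)%E -> frequently (fun t => c%:E < g t)%E.
Proof.
move=> c_lt T; have : (c%:E < ereal_sup (g @` [set t | (T <= t)%R]))%E.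
  by apply: lt_le_trans c_lt _; apply: ereal_inf_lbound; exists T.
by move=> /ereal_sup_gt[_ [t Tt <-] ct]; exists t.
Qed.

Lemma limsup_infty_lt g c : (limsup_infty g < c%:E)%E -> \forall t \near +oo, (g t < c%:E)%E.
Proof.
move=> /ereal_inf_lt[_ [T _ <-] lt_c]; exists T; split=> [|t Tt]; first exact: num_real.
by apply: le_lt_trans lt_c; apply: ereal_sup_ubound; exists t => //; exact: ltW.
Qed.

Lemma rlimsup_at_eq0 (X : Type) (rho : X -> X -> R) x (g : X -> \bar R) :
  is_metric rho -> (forall y, g y = 0%E) -> rlimsup_at rho x g = 0%E.
Proof.
move=> rho_metric g0; apply/eqP; rewrite eq_le; apply/andP; split.
  apply: ge_ereal_inf; eexists; first by exists 1 => //=; exact: ltr01.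
  by apply: ge_ereal_sup => _ [y _ <-]; rewrite g0.
apply: le_ereal_inf_tmp => _ [r /= r0 <-]; apply: le_ereal_sup_tmp.
by exists 0%E => //; exists x; [exact: rball_center | exact: g0].
Qed.

Lemma rlimsup_at_lt (X : Type) (rho : X -> X -> R) x (g : X -> \bar R) c :
  (rlimsup_at rho x g < c%:E)%E ->
  exists2 r : R, 0 < r & forall y, rball rho x r y -> (g y < c%:E)%E.
Proof.
move=> /ereal_inf_lt[_ [r r0 <-] lt_c]; exists r => // y xy.
by apply: le_lt_trans lt_c; apply: ereal_sup_ubound; exists y.
Qed.

End LimsupInfty.

(** * Transition probabilities and time averages of the process *)

Section Process.
Context {R : realType} {d : measure_display} {X : measurableType d} (rho : X -> X -> R).
Context {dO : measure_display} {Omega : measurableType dO}.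
Variables (Px : X -> probability Omega R) (Phi : R -> Omega -> X).
Hypothesis rho_polish : polish rho.
Hypothesis borel : @measurable d X = <<s ropen rho >>.
Hypothesis markov : cadlag_feller_markov Px Phi rho.
Local Notation RR := (measurableTypeR R).
Implicit Types (s t u S T : R) (x : X) (f g : X -> R) (A : set X) (mu nu : probability X R).

Let rho_metric : is_metric rho. Proof. by case: rho_polish. Qed.

Let max0_ge0 (t : R) : 0 <= Num.max 0 t. Proof. by rewrite le_max lexx. Qed.

Lemma measurable_marginal t : 0 <= t -> measurable_fun setT (Phi t).
Proof. by case: markov => mPhi _ _ _ _; exact: mPhi. Qed.

Definition marginal (t : R) : {mfun Omega >-> X} :=
  mfun_Sub (mem_set (measurable_marginal (max0_ge0 t))).

(* Constant for [t <= 0], so that it is a kernel on the whole line of times. *)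
Definition transition (t : RR) (x : X) : probability X R := distribution (Px x) (marginal t).

Lemma transitionE t x A : 0 <= t -> transition t x A = Pt Px Phi t x A.
Proof. by move=> t0; rewrite -[in RHS](max_idPr t0). Qed.

Lemma ge0_integral_transition t x (f : X -> \bar R) : 0 <= t ->
  measurable_fun setT f -> (forall y, 0 <= f y)%E ->
  (\int[transition t x]_y f y = \int[Px x]_w f (Phi t w))%E.
Proof.
move=> t0 mf f0; rewrite (ge0_integral_distribution (marginal t))//=.
by rewrite (max_idPr t0).
Qed.

Lemma expect_transition t x (f : X -> R) : 0 <= t -> measurable_fun setT f ->
  (Px x).-integrable setT (fun w => (f (Phi t w))%:E) ->
  expect (transition t x) f = Pf Px Phi t f x.
Proof.
move=> t0 mf intf; congr fine; rewrite (integral_distribution (X := marginal t)) /=.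
- by rewrite (max_idPr t0).
- exact/measurable_EFinP.
- by rewrite /= (max_idPr t0).
Qed.

Lemma unit_fun_marginal t (f : X -> R) : 0 <= t -> unit_fun f -> unit_fun (f \o Phi t).
Proof. by move=> t0; apply: unit_fun_comp; exact: measurable_marginal. Qed.

Lemma expect_transition_unit t x f : 0 <= t -> unit_fun f ->
  expect (transition t x) f = expect (Px x) (f \o Phi t).
Proof.
move=> t0 uf; apply: expect_transition => //; first exact: measurable_unit_fun.
by apply: unit_fun_integrable; exact: unit_fun_marginal.
Qed.

Lemma transition_max0 t x : transition (Num.max 0 t) x = transition t x.
Proof.
by congr distribution; apply: val_inj; rewrite /= (max_idPr (max0_ge0 t)).
Qed.

Lemma measurable_transition_space t A : measurable A ->
  measurable_fun setT (fun y => transition t y A).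
Proof.
move=> mA; have [_ _ [_ measurable_Pt] _ _] := markov.
under eq_fun do rewrite -transition_max0 transitionE//.
exact: measurable_Pt.
Qed.

Lemma unit_fun_transition_space t f : unit_fun f ->
  unit_fun (fun y => expect (transition t y) f).
Proof. by apply: unit_fun_expect => A; exact: measurable_transition_space. Qed.

Lemma feller_transition t g : 0 <= t -> rcontinuous rho g -> unit_fun g ->
  rcontinuous rho (fun y => expect (transition t y) g).
Proof.
move=> t0 cg ug; have [_ _ _ _ feller] := markov.
rewrite (_ : (fun y => _) = Pf Px Phi t g).
  by apply: feller => //; exists 1 => x; exact: unit_fun_norm.
apply/funext => y; apply: expect_transition => //; first exact: measurable_unit_fun.
by apply: unit_fun_integrable; exact: unit_fun_marginal.
Qed.

Lemma transition_right_continuous (t_ : nat -> R) t x g : 0 <= t -> (forall n, t <= t_ n) ->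
  t_ n @[n --> \oo] --> t -> rcontinuous rho g -> unit_fun g ->
  expect (transition (t_ n) x) g @[n --> \oo] --> expect (transition t x) g.
Proof.
move=> t0 t_t t_cvg cg ug; have [_ cadlag_Phi _ _ _] := markov.
have t_0 n : 0 <= t_ n := le_trans t0 (t_t n).
under eq_fun do rewrite expect_transition_unit//.
rewrite expect_transition_unit//; apply: expect_cvg => [n||w]; [exact: unit_fun_marginal..|].
apply: (rcontinuous_cvg cg) => e e0.
have [/(_ t t0 e e0)[r [r0 right_r]] _] := cadlag_Phi w.
move/cvgrPdist_lt : t_cvg => /(_ r r0); apply: filterS => n.
by rewrite distrC ltr_distl => /andP[_ t_r]; exact: right_r.
Qed.

Let grid_index (n : nat) (s : RR) : nat := Num.truncn (Num.max 0 s * n.+1%:R).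

Let grid_index_itv n s :
  (grid_index n s)%:R <= Num.max 0 s * n.+1%:R < (grid_index n s).+1%:R.
Proof. by apply: truncn_itv; rewrite mulr_ge0. Qed.

Let grid (n : nat) (s : RR) : R := (grid_index n s).+1%:R / n.+1%:R.

Let le_grid n s : Num.max 0 s <= grid n s.
Proof. by rewrite ler_pdivlMr ?ltr0n//; have /andP[_ /ltW] := grid_index_itv n s. Qed.

Let grid_cvg s : grid n s @[n --> \oo] --> Num.max 0 s.
Proof.
apply: (@squeeze_cvgr _ _ _ _ (fun=> Num.max 0 s) (fun n => Num.max 0 s + n.+1%:R^-1)).
- apply: nearW => n; rewrite le_grid /grid ler_pdivrMr ?ltr0n// mulrDl mulVf// -natr1 lerD2r.
  by have /andP[] := grid_index_itv n s.
- exact: cvg_cst.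
- by rewrite -[X in _ --> X]addr0; apply: cvgD; [exact: cvg_cst | exact: cvg_harmonic].
Qed.

Let measurable_grid_index n k : measurable (grid_index n @^-1` [set k]).
Proof.
rewrite (_ : _ @^-1` _ = (fun s : RR => Num.max 0 s * n.+1%:R : RR) @^-1` `[k%:R, k.+1%:R[%classic).
  have mscale : measurable_fun setT (fun s : RR => Num.max 0 s * n.+1%:R : RR).
    by apply: measurable_funM => //; exact: measurable_maxr.
  by rewrite -[X in measurable X]setTI; exact: mscale.
apply/seteqP; split=> s /=; rewrite in_itv/=; first by move=> <-; exact: grid_index_itv.
by move=> /truncn_def.
Qed.

Let measurable_grid_section n (G : nat -> X -> R) : (forall k, measurable_fun setT (G k)) ->
  measurable_fun setT (fun p : RR * X => G (grid_index n p.1) p.2).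
Proof.
move=> mG _ B mB; rewrite setTI.
rewrite (_ : _ @^-1` B = \bigcup_k (grid_index n @^-1` [set k] `*` (G k @^-1` B))).
  apply: bigcupT_measurable => k; apply: measurableX; first exact: measurable_grid_index.
  by rewrite -[X in measurable X]setTI; exact: mG.
by apply/seteqP; split => -[s y] /=; [by exists (grid_index n s) | by move=> [k _ [<-]]].
Qed.

Let measurable_expect_transition g : rcontinuous rho g -> unit_fun g ->
  measurable_fun setT (fun p : RR * X => expect (transition p.1 p.2) g).
Proof.
move=> cg ug.
apply: (@measurable_fun_cvg _ _ _ setT
  (fun n (p : RR * X) => expect (transition (grid n p.1) p.2) g)) => [n|[s y] _ /=].
  apply: (measurable_grid_section n
    (G := fun k y => expect (transition (k.+1%:R / n.+1%:R) y) g)) => k.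
  exact/measurable_unit_fun/unit_fun_transition_space.
rewrite -transition_max0; apply: transition_right_continuous => //; exact: grid_cvg.
Qed.

Lemma measurable_transition A : measurable A ->
  measurable_fun setT (fun p : RR * X => transition p.1 p.2 A).
Proof.
rewrite {1}borel; move: A; apply: (@dynkin_induction _ _ (ropen rho)) => //.
- exact: ropenI.
- by under eq_fun do rewrite probability_setT; exact: measurable_cst.
- move=> U oU; have [g [cg ug _ gU]] := ropen_approx_unit rho_metric borel oU.
  have mU := ropen_measurable borel oU.
  under eq_fun do rewrite -expect_indic//; apply/measurable_EFinP.
  apply: (@measurable_fun_cvg _ _ _ setT
    (fun n (p : RR * X) => expect (transition p.1 p.2) (g n))) => [n|p _].
    exact: measurable_expect_transition.
  by apply: expect_cvg => //; exact: unit_fun_indic.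
- move=> A mA mtA; under eq_fun do rewrite probability_setC//.
  exact: emeasurable_funB.
- move=> F mF tF mtF; have mUF := bigcupT_measurable _ mF.
  under eq_fun do rewrite measure_semi_bigcup//.
  exact: (@ge0_emeasurable_sum _ _ R setT (fun k (p : RR * X) => transition p.1 p.2 (F k)) predT).
Qed.

Lemma unit_fun_transition f : unit_fun f ->
  unit_fun (fun p : RR * X => expect (transition p.1 p.2) f).
Proof. by apply: unit_fun_expect => A; exact: measurable_transition. Qed.

Lemma measurable_transition_time x A : measurable A ->
  measurable_fun setT (fun s : RR => transition s x A).
Proof. by move=> mA; exact: measurable_fun_pair1 (measurable_transition mA). Qed.

Lemma unit_fun_transition_time x f : unit_fun f ->
  unit_fun (fun s : RR => expect (transition s x) f).
Proof. by apply: unit_fun_expect => A; exact: measurable_transition_time. Qed.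

Lemma chapman_kolmogorov s t x f : 0 <= s -> 0 <= t -> unit_fun f ->
  expect (transition (s + t) x) f =
  expect (transition s x) (fun y => expect (transition t y) f).
Proof.
move=> s0 t0 uf; have [_ _ _ markov_property _] := markov.
have mt A : measurable A -> measurable_fun setT (fun y => transition t y A).
  exact: measurable_transition_space.
rewrite -(expect_mixture (transition s x) mt uf); congr fine.
apply: eq_measure_integral => A mA _; rewrite [RHS]mixtureE// [LHS]transitionE ?addr_ge0//.
rewrite ge0_integral_transition//; last exact: mt.
under eq_integral do rewrite transitionE//.
have := markov_property x s t setT A s0 t0 _ mA; rewrite setTI; apply.
by apply: sub_sigma_algebra; exists 0, setT; rewrite lexx s0 preimage_setT.
Qed.

Definition time_average (T : R) (x : X) : probability X R :=
  mixture (uniform_law T) (@measurable_transition_time x).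

Lemma expect_average T x f : unit_fun f ->
  expect (time_average T x) f = expect (uniform_law T) (fun s => expect (transition s x) f).
Proof. exact: expect_mixture. Qed.

Lemma unit_fun_average T f : unit_fun f -> unit_fun (fun y => expect (time_average T y) f).
Proof.
move=> uf; under eq_fun do rewrite expect_average//.
have ut := unit_fun_comp (measurable_swap (T1 := X) (T2 := RR)) (unit_fun_transition uf).
exact: unit_fun_fubini _ ut.
Qed.

Lemma measurable_average T A : measurable A -> measurable_fun setT (fun y => time_average T y A).
Proof.
move=> mA; under eq_fun do rewrite -expect_indic//.
by apply/measurable_EFinP/measurable_unit_fun/unit_fun_average/unit_fun_indic.
Qed.

Lemma feller_average T g : rcontinuous rho g -> unit_fun g ->
  rcontinuous rho (fun y => expect (time_average T y) g).
Proof.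
move=> cg ug; apply: sequentially_rcontinuous => y v v_y.
under eq_fun do rewrite expect_average//; rewrite expect_average//.
apply: expect_cvg => [n||s]; [exact: unit_fun_transition_time..|].
apply: (rcontinuous_cvg (f := fun y => expect (transition s y) g) _ v_y).
under eq_fun do rewrite -transition_max0.
exact: feller_transition.
Qed.

Lemma average_transition S u x f : 0 < S -> 0 <= u -> unit_fun f ->
  expect (time_average S x) (fun y => expect (transition u y) f) =
  expect (uniform_law S) (fun s => expect (transition (s + u) x) f).
Proof.
move=> S0 u0 uf; rewrite expect_average; last exact: unit_fun_transition_space.
apply: eq_expect_uniform => // [||s /andP[s0 _]].
- exact/unit_fun_transition_time/unit_fun_transition_space.
- exact: unit_fun_comp (measurable_shift u) (unit_fun_transition_time x uf).
- by rewrite -chapman_kolmogorov.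
Qed.

Lemma average_transition_shift S u x f : 0 < S -> 0 <= u -> unit_fun f ->
  `|expect (time_average S x) (fun y => expect (transition u y) f) -
    expect (time_average S x) f| <= u / S.
Proof.
move=> S0 u0 uf; rewrite average_transition// expect_average//.
exact: expect_uniform_shift (unit_fun_transition_time x uf).
Qed.

Lemma average_average S T x f : unit_fun f ->
  expect (time_average S x) (fun y => expect (time_average T y) f) =
  expect (uniform_law T) (fun u => expect (time_average S x) (fun y => expect (transition u y) f)).
Proof.
move=> uf; rewrite (expect_fubini _ _ (unit_fun_transition uf)) /=.
by apply: eq_Rintegral => y _; exact: expect_average.
Qed.

Lemma average_comm S T x f : 0 < S -> 0 < T -> unit_fun f ->
  expect (time_average S x) (fun y => expect (time_average T y) f) =
  expect (time_average T x) (fun y => expect (time_average S y) f).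
Proof.
move=> S0 T0 uf.
have ut2 : unit_fun (fun p : RR * RR => expect (transition (p.1 + p.2) x) f).
  have madd : measurable_fun setT (fun p : RR * RR => p.1 + p.2 : RR) by exact: measurable_funD.
  exact: (unit_fun_comp madd (unit_fun_transition_time x uf)).
have uniform2 S' T' : 0 < S' -> 0 < T' ->
    expect (time_average S' x) (fun y => expect (time_average T' y) f) =
    expect (uniform_law T') (fun u =>
      expect (uniform_law S') (fun s => expect (transition (s + u) x) f)).
  move=> S'0 T'0; rewrite average_average//; apply: eq_expect_uniform => // [||u /andP[u0 _]].
  - exact: unit_fun_fubini (unit_fun_transition uf).
  - exact: unit_fun_fubini _ (unit_fun_comp (measurable_swap (T1 := RR) (T2 := RR)) ut2).
  - exact: average_transition.
rewrite !uniform2// -(expect_fubini _ _ ut2) /=.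
by under eq_Rintegral do under eq_Rintegral do rewrite addrC.
Qed.

Lemma average_shift S T x f : 0 < S -> 0 < T -> unit_fun f ->
  `|expect (time_average S x) (fun y => expect (time_average T y) f) -
    expect (time_average S x) f| <= T / S.
Proof.
move=> S0 T0 uf; rewrite average_average//.
rewrite -[X in _ - X](expect_cst (uniform_law T)); apply: expect_uniform_close => //.
- exact: unit_fun_fubini (unit_fun_transition uf).
- by apply: unit_fun_cst; rewrite expect_ge0//= expect_le1.
- move=> u /andP[u0 uT]; apply: le_trans (average_transition_shift x S0 u0 uf) _.
  by rewrite ler_pM2r// invr_gt0.
Qed.

Lemma is_invariantP mu : is_invariant Px Phi mu <-> forall t A, 0 <= t -> measurable A ->
  expect mu (fun y => expect (transition t y) \1_A) = expect mu \1_A.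
Proof.
have expectE t A : 0 <= t -> measurable A ->
    (expect mu (fun y => expect (transition t y) \1_A))%:E = (\int[mu]_y Pt Px Phi t y A)%E.
  move=> t0 mA; rewrite EFin_expect; last exact/unit_fun_transition_space/unit_fun_indic.
  by apply: eq_integral => y _; rewrite expect_indic// transitionE.
split=> [inv t A t0 mA|inv t A t0 mA].
  by apply: EFin_inj; rewrite expectE// inv// expect_indic.
by rewrite -expectE// inv// expect_indic.
Qed.

Lemma tv_limit_invariant x mu : tv_limit time_average mu -> is_invariant Px Phi mu.
Proof.
move=> mu_lim; apply/is_invariantP => t A t0 mA; have uA := unit_fun_indic (R := R) mA.
have uPA := unit_fun_transition_space t uA.
apply/eqP; rewrite -subr_eq0 -normr_le0; apply/ler_addgt0Pr => e e0; rewrite add0r.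
have e30 : 0 < e / 3 by rewrite divr_gt0.
have [T [[close T0] t_small]] : exists T, (tv_close (e / 3) (time_average T x) mu /\ 0 < T) /\
    t / T <= e / 3.
  apply: (@filter_ex _ +oo%R); apply: filterI; last exact: near_div_le.
  by apply: filterI; [exact: mu_lim | exact: nbhs_pinfty_gt].
have := average_transition_shift x T0 t0 uA.
by have := close _ uA; have := close _ uPA; rewrite !ler_norml; lra.
Qed.

Lemma tv_limit_unique mu nu : tv_limit time_average mu ->
  is_invariant Px Phi nu -> forall A, measurable A -> nu A = mu A.
Proof.
move=> mu_lim /(is_invariantP _).1 inv A mA; have uA := unit_fun_indic (R := R) mA.
have inv_transition t : expect nu (fun y => expect (transition t y) \1_A) = expect nu \1_A.
  rewrite -(inv _ A (max0_ge0 t) mA).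
  by apply: eq_Rintegral => y _; rewrite transition_max0.
have inv_average T : expect nu (fun y => expect (time_average T y) \1_A) = expect nu \1_A.
  under eq_Rintegral do rewrite expect_average//.
  rewrite -(expect_fubini (uniform_law T) nu (unit_fun_transition uA)) /=.
  rewrite -[RHS](expect_cst (uniform_law T)).
  by apply: eq_Rintegral => t _; exact: inv_transition.
have average_cvg : expect nu (fun y => expect (time_average n%:R y) \1_A) @[n --> \oo] -->
    expect nu (fun=> expect mu \1_A).
  apply: expect_cvg => [n||y]; first exact: unit_fun_average.
    by apply: unit_fun_cst; rewrite expect_ge0//= expect_le1.
  apply/cvgrPdist_le => e /(mu_lim y)[M [_ close]]; near=> n; rewrite distrC; apply: close => //.
  by near: n; exact: nbhs_infty_gtr.
rewrite -!expect_indic//; congr (_%:E); rewrite -[RHS](expect_cst nu).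
by rewrite -(cvg_lim _ average_cvg)//; under eq_fun do rewrite inv_average; rewrite lim_cst.
Unshelve. all: by end_near. Qed.

(** * Weighted averages and the metric d_V *)

Section Weight.
Variable V : X -> R.
Hypothesis V_ge0 : forall x, 0 <= V x.
Hypothesis V_cont : rcontinuous rho V.
Hypothesis V_H2 : H2 Px Phi (FF_V V).

Definition weight x : R := 1 + V x.

Local Notation w := weight.

Let weight_ge0 x : 0 <= w x. Proof. by rewrite addr_ge0. Qed.

Let measurable_weight : measurable_fun setT w.
Proof. by apply: measurable_funD => //; exact: (rcontinuous_measurable borel). Qed.

Lemma FF_V_weight : FF_V V w.
Proof. by split=> // x; rewrite ger0_norm. Qed.

Lemma FF_V_unit f : unit_fun f -> FF_V V f.
Proof.
move=> uf; split; first exact: measurable_unit_fun.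
by move=> x; apply: le_trans (unit_fun_norm x uf) _; rewrite lerDl.
Qed.

Lemma dominating_weight : exists W : X -> R,
  [/\ in_A Px Phi W, forall x, w x <= W x & forall x, uniformly_integrable W (transition ^~ x)].
Proof.
have [W [W_A W_FF W_ui]] := V_H2; have [mW _] := W_A.
have wW x : w x <= W x by have := W_FF _ FF_V_weight x; rewrite ger0_norm.
have W0 x : 0 <= W x := le_trans (weight_ge0 x) (wW x).
exists W; split => // x e e0.
have Kpos : \forall K \near +oo, 0 < K :> R by exact: nbhs_pinfty_gt.
have [K [K0 K_tail]] := filter_ex (filterI Kpos (cvge0_near_le e0 (W_ui x))).
exists K => // t; rewrite -transition_max0 ge0_integral_transition//; last 2 first.
- exact/measurable_EFinP/measurable_tail.
- by move=> y; rewrite lee_fin tail_ge0.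
apply: le_trans K_tail; apply: ereal_sup_ubound; exists (Num.max 0 t); first exact: max0_ge0.
rewrite integral_mkcond; apply: eq_integral => o _; rewrite patchE /tail.
case: ifPn; [rewrite inE/= | rewrite notin_setE/=]; rewrite ger0_norm//.
  by move=> ->.
by move=> /negP/negbTE ->.
Qed.

Lemma uniformly_integrable_average (W : X -> R) x : measurable_fun setT W -> (forall y, 0 <= W y) ->
  uniformly_integrable W (transition ^~ x) -> uniformly_integrable W (time_average ^~ x).
Proof. exact: uniformly_integrable_mixture. Qed.

Let dominated_lty (m : probability X R) (W : X -> R) :
  measurable_fun setT W -> (forall x, w x <= W x) ->
  (\int[m]_y (W y)%:E < +oo)%E -> (\int[m]_y (w y)%:E < +oo)%E.
Proof.
move=> mW wW; apply: le_lt_trans; apply: ge0_le_integral => //.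
- by move=> y _; rewrite lee_fin.
- exact/measurable_EFinP.
- exact/measurable_EFinP.
- by move=> y _; rewrite lee_fin.
Qed.

Lemma weight_transition_lty t x : (\int[transition t x]_y (w y)%:E < +oo)%E.
Proof.
have [W [[mW _] wW uiW]] := dominating_weight.
apply: (dominated_lty mW wW).
by apply: (uniformly_integrable_lty (p := transition ^~ x)) => // y; exact: le_trans (wW y).
Qed.

Lemma weight_average_lty T x : (\int[time_average T x]_y (w y)%:E < +oo)%E.
Proof.
have [W [[mW _] wW uiW]] := dominating_weight.
have W0 y : 0 <= W y := le_trans (weight_ge0 y) (wW y).
apply: (dominated_lty mW wW); apply: (uniformly_integrable_lty (p := time_average ^~ x)) => //.
exact: uniformly_integrable_average.
Qed.

Lemma FF_V_integrable (m : {measure set X -> \bar R}) f :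
  (\int[m]_y (w y)%:E < +oo)%E -> FF_V V f -> m.-integrable setT (EFin \o f).
Proof. by move=> w_lty [mf fw]; exact: dominated_integrable_lty fw. Qed.

Lemma Pf_expect s x f : 0 <= s -> FF_V V f -> Pf Px Phi s f x = expect (transition s x) f.
Proof.
move=> s0 [mf fw]; have [W [[mW intW] wW _]] := dominating_weight.
rewrite expect_transition//; apply: le_integrable (intW x s s0) => //.
- by apply/measurable_EFinP; exact: measurableT_comp mf (measurable_marginal s0).
- move=> o _ /=; rewrite lee_fin; apply: le_trans (fw _) _.
  by apply: le_trans (wW _) _; exact: ler_norm.
Qed.

(* Tonelli, for functions that need not be bounded. *)
Let ge0_expect_average T x (h : X -> R) : 0 < T -> measurable_fun setT h -> (forall y, 0 <= h y) ->
  (forall s, (transition s x).-integrable setT (EFin \o h)) ->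
  (time_average T x).-integrable setT (EFin \o h) ->
  lebesgue_measure.-integrable `[0, T]%classic (fun s => (expect (transition s x) h)%:E) /\
  expect (time_average T x) h =
  T^-1 * fine (\int[lebesgue_measure]_(s in `[0%R, T]) (expect (transition s x) h)%:E)%E.
Proof.
move=> T0 mh h0 int_P int_Q.
have mhE : measurable_fun setT (fun y => (h y)%:E) by exact/measurable_EFinP.
have h0E y : (0 <= (h y)%:E)%E by rewrite lee_fin.
have P_E : (fun s => (expect (transition s x) h)%:E) = (fun s => \int[transition s x]_y (h y)%:E)%E.
  by apply/funext => s; rewrite fineK//; exact: integrable_fin_num (int_P s).
have mP : measurable_fun setT (fun s : RR => \int[transition s x]_y (h y)%:E)%E.
  apply: (@measurable_fun_integral_kernel _ _ RR X R (transition ^~ x)) => //.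
  exact: measurable_transition_time.
have P0 s : (0 <= \int[transition s x]_y (h y)%:E)%E by exact: integral_ge0.
rewrite P_E.
have Q_E : (\int[time_average T x]_y (h y)%:E = T^-1%:E *
    \int[lebesgue_measure]_(s in `[0%R, T]) \int[transition s x]_y (h y)%:E)%E.
  by rewrite ge0_integral_mixture// ge0_integral_uniform_law.
have fin : (\int[lebesgue_measure]_(s in `[0%R, T]) \int[transition s x]_y (h y)%:E)%E
    \is a fin_num.
  have Q_fin : (\int[time_average T x]_y (h y)%:E)%E \is a fin_num.
    exact: integrable_fin_num int_Q.
  have -> : (\int[lebesgue_measure]_(s in `[0%R, T]) \int[transition s x]_y (h y)%:E =
      T%:E * \int[time_average T x]_y (h y)%:E)%E.
    by rewrite Q_E muleA -EFinM divff ?mul1e// gt_eqF.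
  by rewrite fin_numM.
split; last by rewrite [LHS]/Rintegral Q_E fineM.
apply/integrableP; split; first exact: measurable_funTS.
under eq_integral do rewrite gee0_abs//.
by rewrite -ge0_fin_numE// integral_ge0.
Qed.

Lemma Qf_expect T x f : 0 < T -> FF_V V f -> Qf Px Phi T f x = expect (time_average T x) f.
Proof.
move=> T0 Ff; have [mf fw] := Ff.
have -> : Qf Px Phi T f x =
    T^-1 * fine (\int[lebesgue_measure]_(s in `[0%R, T]) (expect (transition s x) f)%:E)%E.
  rewrite /Qf (_ : [set s : R | 0 <= s <= T] = `[0, T]%classic); last first.
    by apply/seteqP; split => s /=; rewrite in_itv.
  congr (_ * fine _); apply: eq_integral => s /set_mem; rewrite /= in_itv/= => /andP[s0 _].
  by rewrite Pf_expect.
(* [f] is the difference of the nonnegative functions [f + w] and [w]. *)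
pose fw_sum y := f y + w y; have mfw : measurable_fun setT fw_sum by exact: measurable_funD.
have fw0 y : 0 <= fw_sum y by have := fw y; rewrite /fw_sum /weight ler_norml; lra.
have int_w (m : {measure set X -> \bar R}) : (\int[m]_y (w y)%:E < +oo)%E ->
    m.-integrable setT (EFin \o w) by move=> m_lty; exact: FF_V_integrable m_lty FF_V_weight.
have int_fw (m : {measure set X -> \bar R}) : (\int[m]_y (w y)%:E < +oo)%E ->
    m.-integrable setT (EFin \o fw_sum).
  move=> m_lty; exact: (integrableD measurableT (FF_V_integrable m_lty Ff) (int_w _ m_lty)).
have [P_lty Q_lty] := (weight_transition_lty ^~ x, weight_average_lty T x).
have [int_Pfw Q_fw] := ge0_expect_average T0 mfw fw0
  (fun s => int_fw _ (P_lty s)) (int_fw _ Q_lty).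
have [int_Pw Q_w] := ge0_expect_average T0 measurable_weight weight_ge0
  (fun s => int_w _ (P_lty s)) (int_w _ Q_lty).
have f_diff (m : probability X R) : (\int[m]_y (w y)%:E < +oo)%E ->
    expect m f = expect m fw_sum - expect m w.
  move=> m_lty; rewrite -RintegralB//; [|exact: int_fw|exact: int_w].
  by apply: eq_Rintegral => y _; rewrite /fw_sum addrK.
rewrite (f_diff _ Q_lty) Q_fw Q_w -mulrBr; congr (_ * _).
rewrite -fineB; [|exact: (integrable_fin_num _ int_Pfw)|exact: (integrable_fin_num _ int_Pw)].
rewrite -integralB_EFin//; congr fine; apply: eq_integral => s _.
by rewrite -EFinB (f_diff _ (P_lty s)).
Qed.

Lemma Qt_average T x A : 0 < T -> measurable A -> (Qt Px Phi T x A)%:E = time_average T x A.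
Proof.
move=> T0 mA; rewrite /Qt Qf_expect//; last exact/FF_V_unit/unit_fun_indic.
by rewrite expect_indic.
Qed.

Lemma dV_QE T x mu : 0 < T -> dV_Q Px Phi V T x mu = weighted_dist w (time_average T x) mu.
Proof.
move=> T0; congr ereal_inf; apply/seteqP; split=> _ [pi pi_m <-]; exists pi.
- by move=> A mA; have [-> ->] := pi_m A mA; rewrite Qt_average.
- by apply: eq_integral => p _; congr (_%:E); rewrite /weight; lra.
- by move=> A mA; have [-> ->] := pi_m A mA; rewrite Qt_average.
- by apply: eq_integral => p _; congr (_%:E); rewrite /weight; lra.
Qed.

Lemma Qf_dist_le_dV T x mu f : 0 < T -> (\int[mu]_y (w y)%:E < +oo)%E -> FF_V V f ->
  (`|Qf Px Phi T f x - expect mu f|%:E <= dV_Q Px Phi V T x mu)%E.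
Proof.
move=> T0 mu_lty Ff; rewrite Qf_expect// dV_QE//; have [mf fw] := Ff.
apply: expect_dist_le_weighted => //; last exact: weight_average_lty.
exact: (measurable_offdiag rho_polish).
Qed.

Section FromLimit.
Variable mu : probability X R.
Hypothesis FF_integrable : forall f, FF_V V f -> mu.-integrable setT (fun y => (f y)%:E).
Hypothesis dV_cvg0 : forall x, (fun t => dV_Q Px Phi V t x mu) @ +oo%R --> 0%E.

Let mu_lty : (\int[mu]_y (w y)%:E < +oo)%E.
Proof. exact: (integrable_lty measurableT (FF_integrable FF_V_weight)). Qed.

Lemma ucec_of_dV_cvg x : ucec_at Px Phi rho (FF_V V) x.
Proof.
apply: rlimsup_at_eq0 => // y; apply: limsup_infty_eq0 => [t|e e0].
  apply: le_ereal_sup_tmp; eexists; first by exists w; [exact: FF_V_weight |].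
  by rewrite lee_fin.
have e20 : 0 < e / 2 by rewrite divr_gt0.
have t_gt : \forall t \near +oo, 0 < t :> R by exact: nbhs_pinfty_gt.
have near_dV v : \forall T \near +oo, (dV_Q Px Phi V T v mu <= (e / 2)%:E)%E.
  exact: cvge0_near_le e20 (dV_cvg0 v).
apply: filterS3 t_gt (near_dV x) (near_dV y) => T T0 dV_x dV_y.
apply: ge_ereal_sup => _ [f Ff <-]; rewrite lee_fin.
have := le_trans (Qf_dist_le_dV x T0 mu_lty Ff) dV_x.
have := le_trans (Qf_dist_le_dV y T0 mu_lty Ff) dV_y.
by rewrite !lee_fin !ler_norml; lra.
Qed.

Lemma C2_of_dV_cvg : exists z, C2_at Px Phi rho z.
Proof.
have [z z_supp] := exists_supporting_point rho_polish borel mu.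
exists z => r r0; pose c := expect mu \1_(rball rho z r) / 2.
have c0 : 0 < c by rewrite divr_gt0// z_supp.
have mB := measurable_rball rho_metric borel z r.
apply: (@lt_le_trans _ _ c%:E); first by rewrite lte_fin.
apply: le_ereal_inf_tmp => _ [x _ <-]; apply: le_limsup_infty => T.
have t_gt : \forall t \near +oo, 0 < t :> R by exact: nbhs_pinfty_gt.
have t_ge : \forall t \near +oo, T <= t by apply: nbhs_pinfty_ge; exact: num_real.
have [t [[t0 Tt] dV_le]] := filter_ex (filterI (filterI t_gt t_ge) (cvge0_near_le c0 (dV_cvg0 x))).
exists t => //.
have := le_trans (Qf_dist_le_dV x t0 mu_lty (FF_V_unit (unit_fun_indic mB))) dV_le.
by rewrite /Qt !lee_fin ler_norml /c; lra.
Qed.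

End FromLimit.

Section ToLimit.
Variable z : X.

Lemma ucec_at_tv_close : ucec_at Px Phi rho (FF_V V) z -> forall e : R, 0 < e ->
  exists2 r : R, 0 < r & forall y, rball rho z r y ->
    \forall T \near +oo, tv_close e (time_average T y) (time_average T z).
Proof.
move=> ucec e e0; have sup_lt : (rlimsup_at rho z (fun y => limsup_infty (fun t =>
    ereal_sup [set `|Qf Px Phi t f y - Qf Px Phi t f z|%:E | f in FF_V V])) < e%:E)%E.
  by rewrite ucec lte_fin.
have [r r0 close] := rlimsup_at_lt sup_lt.
exists r => // y /close/limsup_infty_lt gap_lt; near=> T => f uf.
have T0 : 0 < T by near: T; exact: nbhs_pinfty_gt.
rewrite -!Qf_expect//; [|exact: FF_V_unit..].
rewrite -lee_fin; apply/ltW; apply: (@le_lt_trans _ _ (ereal_sup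
  [set `|Qf Px Phi T f y - Qf Px Phi T f z|%:E | f in FF_V V])); last by near: T.
by apply: ereal_sup_ubound; exists f => //; exact: FF_V_unit.
Unshelve. all: by end_near. Qed.

Lemma C2_at_frequently : C2_at Px Phi rho z -> forall r : R, 0 < r ->
  exists2 c : R, 0 < c & forall x,
    frequently (fun T => c <= expect (time_average T x) \1_(rball rho z r)).
Proof.
move=> c2 r r0; have mB := measurable_rball rho_metric borel z r.
have := c2 r r0; set a := ereal_inf _ => a0.
have [c c0 ca] : exists2 c : R, 0 < c & (c%:E < a)%E.
  move: a0; case: a => [b| |//]; last by exists 1 => //; exact: ltry.
  by rewrite lte_fin => b0; exists (b / 2); rewrite ?divr_gt0// lte_fin; lra.
exists c => // x; have : (c%:E < limsup_infty (fun t => (Qt Px Phi t x (rball rho z r))%:E))%E.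
  by apply: lt_le_trans ca _; apply: ereal_inf_lbound; exists x.
have Tpos : \forall T \near +oo, 0 < T :> R by apply: nbhs_pinfty_gt; exact: num_real.
move=> /lt_limsup_infty/frequently_near/(_ Tpos); apply: sub_frequently => T [].
by move=> + T0; rewrite Qt_average// -expect_indic// lte_fin => /ltW.
Qed.

Lemma exists_average_limit : ucec_at Px Phi rho (FF_V V) z -> C2_at Px Phi rho z ->
  exists mu, tv_limit time_average mu.
Proof.
move=> /ucec_at_tv_close ucec /C2_at_frequently c2.
apply: (exists_tv_limit rho_polish borel _ _ _ _ ucec c2).
- exact: measurable_average.
- exact: average_comm.
- exact: average_shift.
- by move=> T g _; exact: feller_average.
Qed.

Lemma tv_limit_FF_integrable mu f : tv_limit time_average mu -> FF_V V f ->
  mu.-integrable setT (EFin \o f).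
Proof.
move=> mu_lim; apply: FF_V_integrable; have [W [[mW _] wW uiW]] := dominating_weight.
have W0 y : 0 <= W y := le_trans (weight_ge0 y) (wW y).
have uiQ := uniformly_integrable_average mW W0 (uiW z).
apply: (dominated_lty mW wW); apply: (uniformly_integrable_lty (p := fun _ : unit => mu) tt) => //.
move=> e /uiQ[K K0 tail_le]; exists K => // _.
apply: (tv_limit_integral_le (p := time_average ^~ z)) => //; last by move=> y; exact: tail_ge0.
  by move=> r /(mu_lim z)/filter_ex.
exact: measurable_tail.
Qed.

End ToLimit.

Lemma tv_limit_dV_cvg mu x : tv_limit time_average mu ->
  (fun t => dV_Q Px Phi V t x mu) @ +oo%R --> 0%E.
Proof.
move=> mu_lim; have [W [[mW _] wW uiW]] := dominating_weight.
have W0 y : 0 <= W y := le_trans (weight_ge0 y) (wW y).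
apply: (cvg_trans _ (weighted_dist_cvg0 (measurable_offdiag rho_polish borel) measurable_weight mW _
  (uniformly_integrable_average mW W0 (uiW x)) (mu_lim x))).
  apply: near_eq_cvg; near=> T; apply/esym/dV_QE.
  by near: T; exact: nbhs_pinfty_gt.
by move=> y; rewrite weight_ge0 wW.
Unshelve. all: by end_near. Qed.

End Weight.

End Process.

Unset Implicit Arguments.

Theorem mainTheorem8 (R : realType) (d : measure_display) (X : measurableType d)
  (rho : X -> X -> R) (dO : measure_display) (Omega : measurableType dO)
  (Px : X -> probability Omega R) (Phi : R -> Omega -> X) (V : X -> R) :
  polish rho ->
  @measurable d X = <<s ropen rho >> ->
  cadlag_feller_markov Px Phi rho ->
  (forall x, 0 <= V x) -> rcontinuous rho V ->
  H2 Px Phi (FF_V V) ->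
  let i := exists mu : probability X R,
      [/\ is_invariant Px Phi mu,
          (forall nu : probability X R, is_invariant Px Phi nu ->
             forall A, measurable A -> nu A = mu A),
          (forall f, FF_V V f -> mu.-integrable setT (fun y => (f y)%:E)) &
          (forall x, (fun t => dV_Q Px Phi V t x mu) @ +oo%R --> 0%E)] in
  let ii := (forall x, ucec_at Px Phi rho (FF_V V) x) /\
            exists z, C2_at Px Phi rho z in
  let iii := exists z, ucec_at Px Phi rho (FF_V V) z /\ C2_at Px Phi rho z in
  (i <-> ii) /\ (ii <-> iii).
Proof.
move=> rho_polish borel markov V_ge0 V_cont V_H2 i ii iii.
have i_ii : i -> ii.
  move=> [mu [_ _ FF_integrable dV_cvg0]]; split=> [x|].
    exact: (ucec_of_dV_cvg rho_polish borel markov V_ge0 V_cont V_H2 FF_integrable dV_cvg0).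
  exact: (C2_of_dV_cvg rho_polish borel markov V_ge0 V_cont V_H2 FF_integrable dV_cvg0).
have ii_iii : ii -> iii by move=> [ucec [z c2]]; exists z.
have iii_i : iii -> i.
  move=> [z [ucec c2]].
  have [mu mu_lim] := exists_average_limit rho_polish borel markov V_ge0 V_cont V_H2 ucec c2.
  exists mu; split.
  - exact: (tv_limit_invariant z mu_lim).
  - by move=> nu nu_inv A; exact: (tv_limit_unique mu_lim nu_inv).
  - by move=> f; exact: (tv_limit_FF_integrable V_ge0 V_cont V_H2 z mu_lim).
  - by move=> x; exact: (tv_limit_dV_cvg V_ge0 V_cont V_H2 x mu_lim).
by split; [split=> // /ii_iii/iii_i | split=> // /iii_i/i_ii].
Qed.
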